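(* Let $s\in C^2(\mathbb{R}^{B_{\mathbf 0}^r},\mathbb{R})$ be admissible, and suppose there are adjacent $v_0,w_0\in\mathcal{M}_0$ with $v_0<w_0$. Then there is a configuration $U_1\in\mathcal{M}_1(v_0,w_0)$ which is a solution of the Euler–Lagrange equation. Moreover, $\mathcal{M}_1(v_0,w_0)$ is an ordered set, every element of $\mathcal{M}_1(v_0,w_0)$ is a solution of the Euler–Lagrange equation, and every $U\in\mathcal{M}_1(v_0,w_0)$ is strictly $1$-monotone in $\mathbf{i}_1$, i.e. $U<\tau^1_{-1}U$.
   Context: Fix integers $n\ge 1$, $r\ge 1$. For $\mathbf{i}\in\mathbb{Z}^n$ let $\|\mathbf{i}\|=\sum_k|\mathbf{i}_k|$, and $B_{\mathbf 0}^r=\{\mathbf{k}\in\mathbb{Z}^n:\|\mathbf{k}\|\le r\}$; $\mathbf{e}_1,\dots,\mathbf{e}_n$ are the standard unit vectors. A function $s\in C^2(\mathbb{R}^{B_{\mathbf 0}^r},\mathbb{R})$ is called admissible if: (S1) $s(u+1_{B_{\mathbf 0}^r})=s(u)$, with $1_{B_{\mathbf 0}^r}$ the constant function $1$; (S2) $s$ is bounded from below and $s(u)\to\infty$ as $|u(\mathbf{k})-u(\mathbf{j})|\to\infty$, for $\mathbf{k},\mathbf{j}\in B_{\mathbf 0}^r$ with $\|\mathbf{k}-\mathbf{j}\|=1$; (S3) $\partial_{\mathbf{k},\mathbf{j}}s\le 0$ for $\mathbf{k}\ne\mathbf{j}$ in $B_{\mathbf 0}^r$, and $\partial_{\mathbf{0},\mathbf{j}}s<0$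 for $\|\mathbf{j}\|=1$. A configuration is a function $u:\mathbb{Z}^n\to\mathbb{R}$. Shifts: $(\tau^j_{-k}u)(\mathbf{i})=u(\mathbf{i}+k\mathbf{e}_j)$ for $k\in\mathbb{Z}$. Local potentials: $S_{\mathbf{j}}(u)=s\big((\tau^n_{-\mathbf{j}_n}\cdots\tau^1_{-\mathbf{j}_1}u)|_{B_{\mathbf 0}^r}\big)$. A solution of the Euler–Lagrange equation is a configuration $u$ with $\sum_{\mathbf{j}:\|\mathbf{j}-\mathbf{i}\|\le r}\partial_{\mathbf{i}}S_{\mathbf{j}}(u)=0$ for all $\mathbf{i}\in\mathbb{Z}^n$, where $\partial_{\mathbf i}$ is the partial derivative with respect to $u(\mathbf i)$. Orders: $u\le v$ (resp. $u<v$) means $u(\mathbf{i})\le v(\mathbf{i})$ (resp. $u(\mathbf{i})<v(\mathbf{i})$) for all $\mathbf{i}$. A set of configurations is ordered if any two members $u,v$ satisfy $u<v$, $u=v$ or $u>v$. Members $v<w$ of a set $A$ of configurations are adjacent in $A$ if there is no $u\in A$ with $v\le u\le w$, $u\neq v$, $u\ne w$. $\Gamma_0$ is the set of configurations with $u(\mathbf{i}+\mathbf{e}_k)=u(\mathbf{i})$ for all $1\le k\le n$ (i.e. constants), $J_0(u)=S_{\mathbf{0}}(u)$, $c_0=\inf_{\Gamma_0}J_0$, $\mathcal{M}_0=\{u\in\Gamma_0:J_0(u)=c_0\}$. For $i\in\mathbb{Z}$ set $\mathbf{T}_i=(i,0,\dots,0)$, and for $v<w$ in $\mathcal{M}_0$: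 $\hat\Gamma_1(v,w)$ is the set of configurations $u$ with $v\le u\le w$ and $u(\mathbf{i}+\mathbf{e}_k)=u(\mathbf{i})$ for $2\le k\le n$; $J_{1,i}(u)=S_{\mathbf{T}_i}(u)-c_0$; $J_{1;p,q}(u)=\sum_{i=p}^qJ_{1,i}(u)$; $J_1(u)=\liminf_{p\to-\infty,\,q\to\infty}J_{1;p,q}(u)$; $\Gamma_1(v,w)=\{u\in\hat\Gamma_1(v,w): |u(\mathbf{T}_i)-v(\mathbf{T}_i)|\to0 \text{ as } i\to-\infty,\ |u(\mathbf{T}_i)-w(\mathbf{T}_i)|\to0\text{ as }i\to\infty\}$; $c_1(v,w)=\inf_{\Gamma_1(v,w)}J_1$; $\mathcal{M}_1(v,w)=\{u\in\Gamma_1(v,w):J_1(u)=c_1(v,w)\}$. *)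

(* Defs.v *)
From HB Require Import structures.
From mathcomp Require Import all_boot all_order all_algebra.
From mathcomp Require Import all_classical all_reals all_analysis.

Set Implicit Arguments.
Unset Strict Implicit.
Unset Printing Implicit Defensive.

Import Order.TTheory GRing.Theory Num.Theory.
Import numFieldNormedType.Exports.

Local Open Scope classical_set_scope.
Local Open Scope ring_scope.

Definition l1norm n (i : 'rV[int]_n) : nat := (\sum_(k < n) `|i ord0 k|)%N.

(* The ball of radius r around 0 in Z^n; functions on it play the role of
   R^B, B being finite. *)
Notation box n r := {k : 'rV[int]_n | (l1norm k <= r)%N}.

Definition config (R : realType) n := 'rV[int]_n -> R.

(* The derivative of f at u with respect to the coordinate u i. *)
Definition partial (R : realType) (I : eqType) (i : I)
    (f : (I -> R) -> R) (u : I -> R) : R :=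
  derive1 (fun t : R => f [eta u with i |-> t]) (u i).

Definition has_partial (R : realType) (I : eqType) (i : I)
    (f : (I -> R) -> R) (u : I -> R) : Prop :=
  derivable (fun t : R => f [eta u with i |-> t]) (u i) 1.

(* I is a finite index set, so that the topology of pointwise convergence on
   I -> R is the usual one. *)
Definition C1 (R : realType) (I : eqType) (f : (I -> R) -> R) : Prop :=
  [/\ continuous (f : {ptws I -> R} -> R),
      forall i u, has_partial i f u &
      forall i, continuous (partial i f : {ptws I -> R} -> R)].

Definition C2 (R : realType) (I : eqType) (f : (I -> R) -> R) : Prop :=
  C1 f /\ forall i, C1 (partial i f).

Section admissible.
Variables (R : realType) (n r : nat).
Implicit Types (s : (box n r -> R) -> R).

Definition S1 s : Prop := forall u, s (fun k => u k + 1) = s u.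

Definition S2 s : Prop :=
  (exists m : R, forall u, m <= s u) /\
  forall k j : box n r, l1norm (val k - val j) = 1%N ->
    forall M : R, exists N : R, forall u, N <= `|u k - u j| -> M <= s u.

Definition S3 s : Prop :=
  (forall k j : box n r, k != j -> forall u, partial k (partial j s) u <= 0) /\
  (forall o j : box n r, val o = 0 -> l1norm (val j) = 1%N ->
     forall u, partial o (partial j s) u < 0).

Definition admissible s : Prop := [/\ C2 s, S1 s, S2 s & S3 s].

End admissible.

Section configurations.
Variables (R : realType) (n : nat).
Implicit Types (u v w : config R n) (A : set (config R n)).

(* tau k m u is the shift of u by -m in the direction of the k-th unit
   vector. *)
Definition tau (k : 'I_n) (m : int) u : config R n :=
  fun i => u (i + m *: delta_mx ord0 k).

(* The successive shifts by - j_1, ..., - j_n, in this order. *)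
Definition shift_by (j : 'rV[int]_n) u : config R n :=
  foldl (fun v k => tau k (j ord0 k) v) u (enum 'I_n).

Definition local_pot r (s : (box n r -> R) -> R) (j : 'rV[int]_n) u : R :=
  s (fun k => shift_by j u (val k)).

Definition EL_solution r (s : (box n r -> R) -> R) u : Prop :=
  forall i : 'rV[int]_n,
    \sum_(j \in [set j : 'rV[int]_n | (l1norm (j - i) <= r)%N])
      partial i (local_pot s j) u = 0.

Definition cfg_le u v : Prop := forall i, u i <= v i.

Definition cfg_lt u v : Prop := forall i, u i < v i.

Definition is_ordered A : Prop :=
  forall u v, A u -> A v -> [\/ cfg_lt u v, u = v | cfg_lt v u].

Definition adjacent_in A v w : Prop :=
  [/\ A v, A w, cfg_lt v w &
      ~ exists u, [/\ A u, cfg_le v u, cfg_le u w, u <> v & u <> w]].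

Definition Gamma0 : set (config R n) :=
  [set u | forall (k : 'I_n) i, u (i + delta_mx ord0 k) = u i].

Definition J0 r (s : (box n r -> R) -> R) u : R := local_pot s 0 u.

Definition c0 r (s : (box n r -> R) -> R) : R := inf (J0 s @` Gamma0).

Definition M0 r (s : (box n r -> R) -> R) : set (config R n) :=
  [set u | Gamma0 u /\ J0 s u = c0 s].

End configurations.

Section heteroclinic.
(* The dimension is n.+1, and ord0 is the index of the first coordinate. *)
Variables (R : realType) (n r : nat).
Variable s : (box n.+1 r -> R) -> R.
Implicit Types (u v w : config R n.+1).

Definition Tpoint (i : int) : 'rV[int]_n.+1 := i *: delta_mx ord0 ord0.

Definition hatGamma1 v w : set (config R n.+1) :=
  [set u | [/\ cfg_le v u, cfg_le u w &
     forall k : 'I_n.+1, k != ord0 ->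
       forall i, u (i + delta_mx ord0 k) = u i]].

Definition J1i (i : int) u : R := local_pot s (Tpoint i) u - c0 s.

Definition J1pq (p q : int) u : R :=
  \sum_(i \in [set i : int | p <= i <= q]) J1i i u.

(* The lower limit as p = - m tends to - oo and q tends to + oo
   independently. *)
Definition J1 u : \bar R :=
  limf_einf (fun mq : nat * nat => (J1pq (- mq.1%:Z) mq.2%:Z u)%:E)
    (filter_prod \oo \oo).

Definition Gamma1 v w : set (config R n.+1) :=
  [set u | [/\ hatGamma1 v w u,
     `|u (Tpoint (- m%:Z)) - v (Tpoint (- m%:Z))| @[m --> \oo] --> (0 : R) &
     `|u (Tpoint m%:Z) - w (Tpoint m%:Z)| @[m --> \oo] --> (0 : R)]].

Definition c1 v w : \bar R := ereal_inf (J1 @` Gamma1 v w).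

Definition M1 v w : set (config R n.+1) :=
  [set u | Gamma1 v w u /\ J1 u = c1 v w].

End heteroclinic.

(* Main.v *)
Require Import Defs.
From HB Require Import structures.
From mathcomp Require Import all_boot all_order all_algebra.
From mathcomp Require Import all_classical all_reals all_analysis.
From mathcomp Require Import zify ring lra.

Set Implicit Arguments.
Unset Strict Implicit.
Unset Printing Implicit Defensive.

Import Order.TTheory GRing.Theory Num.Theory.
Import numFieldNormedType.Exports.

Local Open Scope classical_set_scope.
Local Open Scope ring_scope.

(** A member of Gamma1 is a sequence x : int -> R, extended to the lattice so as
    to depend on the first coordinate only, and its energy is the sum over t of
    h (shift t x), where h x is s evaluated on x along the ball, minus c0.  As
    the mixed second derivatives of s are nonpositive, h is submodular for the
    pointwise minimum and maximum; as s is C1, h is Lipschitz on sequences with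
    values in [a, b], where a < b are the two adjacent constants.

    Submodularity lets one sort: replacing P consecutive translates of x by
    their pointwise order statistics does not increase the total energy
    (submodular_ostat).  If x is P-periodic the order statistics are constants,
    so a period of a periodic sequence has nonnegative energy; by closing up,
    every finite stretch of every sequence has energy bounded below (back_ge).
    The infimum phi of the energies of the left halves that end like x is then
    a Lipschitz corrector: h x + phi x - phi (shift 1 x) >= 0 (phi_step).
    Adding the corrector turns partial sums of the energy into nondecreasing
    ones, up to boundary terms that converge on sequences joining a to b.  Hence
    the energy of such a sequence is a limit as soon as it is finite, it is
    lower semicontinuous, and it behaves well under shifts, minima and maxima.

    Existence (minimizer_exists): a sequence of almost minimal energy may be
    truncated, and if x t <= x (t + P) for all t, as is the case for a
    truncated sequence and P large, then the order statistics of its translates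
    are monotone sequences, one of which has no more energy than x.  So there is
    a minimizing sequence of monotone sequences; shifted so that they cross the
    level (a + b) / 2 at 0, they have a pointwise limit along an ultrafilter.
    That limit is monotone and has finite energy, so its limits at infinity are
    constants c with h c = 0 on either side of the middle level; by adjacency
    they are a and b.

    Euler-Lagrange equation and order: the left-hand side of the equation at a
    site is nonincreasing in the values at other sites, strictly so in those at
    the nearest neighbours.  This gives a strong maximum principle: two ordered
    solutions that touch coincide.  Comparison with the constants a and b shows
    that a minimizer stays strictly between them, so it may be varied in both
    directions and solves the equation (minimal_EL).  The maximum of two
    minimizers is a minimizer, which touches one of them, so any two minimizers
    are ordered (minimal_ordered); applied to a minimizer and its shift this
    yields strict monotonicity, the order being decided by a < b. *)

(** * Sorting with a pair of lattice operations *)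

(** Insertion sort is written with the operations min and max themselves, so
    that it can be run on sequences with pointwise operations and commutes with
    evaluation at a site. *)
Fixpoint insert T (mn mx : T -> T -> T) (z : T) (c : seq T) : seq T :=
  if c is y :: c' then mn z y :: insert mn mx (mx z y) c' else [:: z].

Definition isort T (mn mx : T -> T -> T) : seq T -> seq T :=
  foldr (insert mn mx) [::].

Section insertion_sort.
Variables (d : Order.disp_t) (T : orderType d).
Implicit Types (z : T) (c : seq T).
Local Notation ins := (insert (@Order.min d T) Order.max).
Local Notation srt := (isort (@Order.min d T) Order.max).

Lemma perm_insert z c : perm_eq (ins z c) (z :: c).
Proof.
elim: c z => [|y c IH] z //=.
have [zy|yz] := leP z y; first by rewrite perm_cons.
apply: (@perm_trans _ (y :: z :: c)); first by rewrite perm_cons.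
by apply/permP => p /=; rewrite addnCA.
Qed.

Lemma perm_isort c : perm_eq (srt c) c.
Proof.
elim: c => //= z c IH; apply: perm_trans (perm_insert _ _) _.
by rewrite perm_cons.
Qed.

Lemma size_isort c : size (srt c) = size c.
Proof. exact/perm_size/perm_isort. Qed.

Lemma sorted_insert z c : sorted <=%O c -> sorted <=%O (ins z c).
Proof.
have H y : forall c z, path <=%O y c -> (y <= z)%O -> path <=%O y (ins z c).
  move=> {}c; elim: c y => [|y' c IH] y {}z /=; first by rewrite andbT.
  case/andP=> yy' pc yz; apply/andP; split; first by rewrite le_min yz yy'.
  have [zy|zy] := leP z y'; last exact: IH _ _ pc (ltW zy).
  by apply: IH => //; case: (c) pc => //= t c' /andP[/(le_trans zy)-> ->].
case: c => [|y c] //= pc.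
have [zy|zy] := leP z y; last exact: H _ _ _ pc (ltW zy).
by apply: H => //; case: (c) pc => //= t c' /andP[/(le_trans zy)-> ->].
Qed.

Lemma sorted_isort c : sorted <=%O (srt c).
Proof. by elim: c => //= z c IH; apply: sorted_insert. Qed.

Lemma eq_isort c c' : perm_eq c c' -> srt c = srt c'.
Proof.
move=> cc'; apply: (sorted_eq le_trans le_anti); rewrite ?sorted_isort //.
apply: perm_trans (perm_isort _) _; apply: perm_trans cc' _.
by rewrite perm_sym perm_isort.
Qed.

Lemma isort_le c c' : all2 <=%O c c' -> all2 <=%O (srt c) (srt c').
Proof.
have H y y' : forall c c', (y <= y')%O -> all2 <=%O c c' ->
    all2 <=%O (ins y c) (ins y' c').
  move=> {}c; elim: c y y' => [|z c IH] y y' [|z' {}c'] //=.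
    by move=> ->.
  move=> yy' /andP[zz' cc']; apply/andP; split.
    by rewrite le_min !ge_min yy' zz' orbT.
  by apply: IH => //; rewrite ge_max !le_max yy' zz' orbT.
by elim: c c' => [|z c IH] [|z' c'] //= /andP[zz' /IH cc']; apply: H.
Qed.

End insertion_sort.

(** * Order statistics of consecutive values of a sequence *)

Section order_statistics.
Variable R : realType.
Implicit Types (x y z : int -> R) (t : int).

Definition shift t x : int -> R := fun j => x (j + t).

Definition fmin x y : int -> R := fun j => Num.min (x j) (y j).
Definition fmax x y : int -> R := fun j => Num.max (x j) (y j).

Definition submodular (h : (int -> R) -> R) : Prop :=
  forall x y, h (fmin x y) + h (fmax x y) <= h x + h y.

Lemma shift0 x : shift 0 x = x.
Proof. by apply/funext => j; rewrite /shift addr0. Qed.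

Lemma eq_shift x t t' : t = t' -> shift t x = shift t' x.
Proof. by move->. Qed.

Lemma shiftD t t' x : shift t (shift t' x) = shift (t + t') x.
Proof. by apply/funext => j; rewrite /shift addrA. Qed.

(** Each elementary step of the sort replaces two sequences by their minimum and
    maximum. *)
Lemma submodular_isort (h : (int -> R) -> R) (c : seq (int -> R)) :
  submodular h ->
  \sum_(z <- isort fmin fmax c) h z <= \sum_(z <- c) h z.
Proof.
move=> hsub; elim: c => [|y c IH] /=; first by rewrite !big_nil.
rewrite big_cons; apply: le_trans (lerD (lexx _) IH).
elim: (isort _ _ _) (y) => [|z c' IHc] y' /=; first by rewrite !big_cons.
rewrite !big_cons; have := IHc (fmax y' z); have := hsub y' z; lra.
Qed.

Lemma isort_eval (c : seq (int -> R)) t :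
  [seq z t | z <- isort fmin fmax c] =
  isort Order.min Order.max [seq z t | z <- c].
Proof.
elim: c => //= y c <-.
by elim: (isort _ _ _) (y) => //= z c' IH y'; rewrite IH.
Qed.

Definition window x (P : nat) t : seq R := [seq x (t + i%:Z) | i <- iota 0 P].

Definition ostat x (P k : nat) : int -> R :=
  fun t => nth 0 (isort Order.min Order.max (window x P t)) k.

Lemma size_window x P t : size (window x P t) = P.
Proof. by rewrite size_map size_iota. Qed.

Lemma ostat_mem x P k t : (k < P)%N ->
  exists2 i : nat, (i < P)%N & ostat x P k t = x (t + i%:Z).
Proof.
move=> kP; have : ostat x P k t \in window x P t.
  by rewrite -(perm_mem (perm_isort _)) mem_nth // size_isort size_window.
by case/mapP => i; rewrite mem_iota add0n => /andP[_ iP] ->; exists i.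
Qed.

Lemma shift_ostat x P k t : shift t (ostat x P k) = ostat (shift t x) P k.
Proof.
apply/funext => j; rewrite /shift /ostat /window; congr (nth _ (isort _ _ _) _).
by apply: eq_map => i; congr x; lia.
Qed.

Lemma submodular_ostat (h : (int -> R) -> R) x P : submodular h ->
  \sum_(k < P) h (ostat x P k) <= \sum_(i < P) h (shift i%:Z x).
Proof.
move=> hsub; pose c := [seq shift i%:Z x | i <- iota 0 P].
have szc : size (isort fmin fmax c) = P.
  have := congr1 size (isort_eval c 0).
  by rewrite size_map size_isort !size_map size_iota.
have -> : \sum_(i < P) h (shift i%:Z x) = \sum_(z <- c) h z.
  by rewrite big_map -(big_mkord xpredT (fun i => h (shift i%:Z x))) /index_iota subn0.
apply: le_trans (submodular_isort _ hsub).
rewrite (big_nth (fun=> 0)) szc big_mkord; apply: ler_sum => k _.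
rewrite le_eqVlt; apply/orP; left; apply/eqP; congr h; apply/funext => t.
rewrite /ostat; have -> : window x P t = [seq z t | z <- c].
  by rewrite /c -map_comp; apply: eq_map.
by rewrite -isort_eval (nth_map (fun=> 0)) // szc.
Qed.

Lemma window_step x P t :
  exists c, perm_eq (window x P.+1 t) (x t :: c) /\
            perm_eq (window x P.+1 (t + 1)) (x (t + P.+1%:Z) :: c).
Proof.
exists (window x P (t + 1)); split.
  rewrite /window /= addr0 perm_cons (iotaDl 1 0) -map_comp.
  rewrite (@eq_map _ _ _ (fun i : nat => x (t + 1 + i%:Z))) // => i /=.
  by congr x; lia.
rewrite /window -addn1 iotaD map_cat /= -cat1s perm_catC /= add0n.
by rewrite (_ : t + 1 + P%:Z = t + (P + 1)%N%:Z) //; lia.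
Qed.

(** When x t <= x (t + P), moving the window by one site amounts, up to order, to
    increasing one of its values. *)
Lemma ostat_monotone x P k : (forall t, x t <= x (t + P%:Z)) ->
  forall t, ostat x P k t <= ostat x P k (t + 1).
Proof.
case: P => [|P] xP t; first by rewrite /ostat /window /= nth_nil.
have [c [c1 c2]] := window_step x P t.
rewrite /ostat (eq_isort c1) (eq_isort c2).
have : all2 <=%O (x t :: c) (x (t + P.+1%:Z) :: c).
  by rewrite /= xP /=; elim: (c) => //= u c' ->; rewrite lexx.
move/isort_le => /=.
set A := insert _ _ _ _; set B := insert _ _ _ _.
elim: A B k => [|u A IH] [|v B] [|k] //= /andP[uv AB] //; exact: IH.
Qed.

Lemma ostat_periodic x P k : (forall t, x (t + P%:Z) = x t) ->
  forall t, ostat x P k t = ostat x P k 0.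
Proof.
case: P => [|P] xP; first by move=> t; rewrite /ostat /window /= !nth_nil.
have step t : ostat x P.+1 k (t + 1) = ostat x P.+1 k t.
  have [c [c1 c2]] := window_step x P t.
  by rewrite /ostat (eq_isort c1) (eq_isort c2) xP.
elim/int_rect => // n IH; first by rewrite -[n.+1]addn1 PoszD step.
by rewrite -step -IH; congr ostat; lia.
Qed.

End order_statistics.

(** * Chains: excess energy over a corrector *)

Section chain.
Variables (R : realType) (a b L : R) (r : nat) (h : (int -> R) -> R).
Implicit Types (x y z : int -> R) (t p : int) (k N : nat).

Definition between x : Prop := forall t, a <= x t <= b.

Definition near_window (e : R) x y : Prop :=
  forall j : int, - r%:Z <= j <= r%:Z -> `|x j - y j| <= e.

Definition window_lipschitz (C : R) (f : (int -> R) -> R) : Prop :=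
  forall x y e, between x -> between y -> near_window e x y ->
    `|f x - f y| <= C * e.

Hypothesis le_ab : a <= b.
Hypothesis L_ge0 : 0 <= L.
Hypothesis h_lip : window_lipschitz L h.
Hypothesis h_sub : submodular h.
Hypothesis h_cst_ge0 : forall c, a <= c <= b -> 0 <= h (fun=> c).
Hypothesis h_a : h (fun=> a) = 0.
Hypothesis h_b : h (fun=> b) = 0.

Lemma between_cst c : a <= c <= b -> between (fun=> c).
Proof. by move=> abc t. Qed.

Lemma between_shift x t : between x -> between (shift t x).
Proof. by move=> Kx j; apply: Kx. Qed.

Lemma h_local x y : between x -> between y ->
  (forall j : int, - r%:Z <= j <= r%:Z -> x j = y j) -> h x = h y.
Proof.
move=> Kx Ky xy; apply/eqP; rewrite -subr_eq0 -normr_le0 -(mulr0 L).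
by apply: h_lip => // j jr; rewrite xy // subrr normr0.
Qed.

Lemma h_bound x : between x -> `|h x| <= L * (b - a).
Proof.
move=> Kx; rewrite -[h x]subr0 -h_a; apply: h_lip => // [t|j _].
  by rewrite lexx le_ab.
by have /andP[] := Kx j; rewrite ler_norml => ? ?; apply/andP; split; lra.
Qed.

(** Sorting the translates over a period gives constants. *)
Lemma periodic_ge0 x (P : nat) : between x ->
  (forall t, x (t + P%:Z) = x t) -> 0 <= \sum_(i < P) h (shift i%:Z x).
Proof.
move=> Kx xP; apply: le_trans (submodular_ostat x P h_sub).
apply: sumr_ge0 => k _.
have -> : ostat x P k = fun=> ostat x P k 0.
  by apply/funext => t; apply: ostat_periodic.
by apply: h_cst_ge0; have [i _ ->] := ostat_mem x 0 (ltn_ord k); apply: Kx.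
Qed.

Definition back y k : R := \sum_(l < k) h (shift (- l.+1%:Z) y).

Lemma back_shift y k : back (shift 1 y) k.+1 = h y + back y k.
Proof.
rewrite /back big_ord_recl shiftD /= (_ : - 1%:Z + 1 = 0) ?shift0 //.
congr (_ + _); apply: eq_bigr => i _; rewrite shiftD; congr h; apply: eq_shift.
by rewrite /bump /=; lia.
Qed.

Lemma back_periodic_ge0 y (P : nat) : between y ->
  (forall t, y (t + P%:Z) = y t) -> 0 <= back y P.
Proof.
move=> Ky yP; have yP' t : shift (- P%:Z) y (t + P%:Z) = shift (- P%:Z) y t.
  by rewrite /shift addrAC yP.
have := periodic_ge0 (between_shift (- P%:Z) Ky) yP'.
rewrite /back (reindex_inj rev_ord_inj) /=; congr (_ <= _).
apply: eq_bigr => i _; rewrite shiftD; congr h; apply: eq_shift.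
by have := ltn_ord i; lia.
Qed.

Definition floor_const : R := (2 * r)%:R * (L * (b - a)).

Lemma floor_const_ge0 : 0 <= floor_const.
Proof. by rewrite !mulr_ge0 // subr_ge0. Qed.

(** Closing up the stretch of y seen by the sum into a periodic sequence costs
    at most 2r further terms. *)
Lemma back_ge y k : between y -> - floor_const <= back y k.
Proof.
move=> Ky; pose P := (k + 2 * r)%N.
pose y' : int -> R := fun j => y (((j + k%:Z + r%:Z) %% P%:Z)%Z - k%:Z - r%:Z).
have Ky' : between y' by move=> t; apply: Ky.
have y'P t : y' (t + P%:Z) = y' t.
  rewrite /y' (_ : t + P%:Z + _ + _ = t + k%:Z + r%:Z + P%:Z) ?modzDr //; lia.
have := back_periodic_ge0 Ky' y'P; rewrite /back big_split_ord /=.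
set A := \sum_(i < k) _; set B := \sum_(i < 2 * r) _ => AB.
have -> : \sum_(l < k) h (shift (- l.+1%:Z) y) = A.
  apply: eq_bigr => l _; apply: h_local; try exact: between_shift.
  move=> j jr; rewrite /shift /y' modz_small; last first.
    by have := ltn_ord l; rewrite /P; lia.
  by congr y; lia.
suff : B <= floor_const by move: AB; lra.
rewrite /floor_const mulr_natl -[X in _ *+ X]card_ord -sumr_const.
apply: ler_sum => i _; apply: le_trans (ler_norm _) _.
exact/h_bound/between_shift.
Qed.

(** The corrector, a weak KAM solution of the chain: the least energy with which
    the part of x to the right of -r can be reached from the left. *)
Definition phi x : R := inf [set e | exists k y, [/\ between y,
  forall j : int, - r%:Z <= j -> y j = x j & e = back y k]].

Lemma phi_le x y k : between y -> (forall j : int, - r%:Z <= j -> y j = x j) ->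
  phi x <= back y k.
Proof.
move=> Ky yx; apply: ge_inf; last by exists k, y.
by exists (- floor_const) => _ [k' [y' [Ky' _ ->]]]; apply: back_ge.
Qed.

Lemma le_phi x c : between x ->
  (forall y k, between y -> (forall j : int, - r%:Z <= j -> y j = x j) ->
     c <= back y k) -> c <= phi x.
Proof.
move=> Kx H; apply: lb_le_inf; first by exists (back x 0), 0%N, x.
by move=> _ [k [y [Ky yx ->]]]; apply: H.
Qed.

Lemma phi_le0 x : between x -> phi x <= 0.
Proof.
by move=> Kx; have := @phi_le x x 0 Kx (fun _ _ => erefl); rewrite /back big_ord0.
Qed.

Lemma phi_ge x : between x -> - floor_const <= phi x.
Proof. by move=> Kx; apply: le_phi => // y k Ky _; apply: back_ge. Qed.

(** A left continuation of x followed by x itself is one of shift 1 x. *)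
Lemma phi_step x : between x -> phi (shift 1 x) <= phi x + h x.
Proof.
move=> Kx; rewrite -lerBlDr; apply: le_phi => // y k Ky yx.
rewrite lerBlDr addrC.
have -> : h x = h y by apply: h_local => // j /andP[jr _]; rewrite yx.
rewrite -back_shift; apply: phi_le; first exact: between_shift.
by move=> j jr; rewrite /shift yx //; lia.
Qed.

Lemma sum_le_initial (F : nat -> R) (M k : nat) (c : R) : 0 <= c ->
  (forall l, F l <= c) -> (forall l, (M <= l)%N -> F l <= 0) ->
  \sum_(l < k) F l <= M%:R * c.
Proof.
move=> c0 Fc F0; suff : \sum_(l < k) F l <= (minn k M)%:R * c.
  move/le_trans; apply; rewrite ler_wpM2r // ler_nat; lia.
elim: k => [|k IH]; first by rewrite big_ord0 min0n mul0r.
rewrite big_ord_recr /=; have [kM|Mk] := ltnP k M.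
  have -> : minn k.+1 M = (minn k M).+1 by lia.
  by rewrite -natr1 mulrDl mul1r lerD.
have -> : minn k.+1 M = minn k M by lia.
by rewrite -[leRHS]addr0 lerD // F0.
Qed.

(** Changing the end of a left continuation affects at most 2r sites. *)
Lemma phi_lip : window_lipschitz ((2 * r)%:R * L) phi.
Proof.
suff H x x' e : between x -> between x' -> near_window e x x' ->
    phi x' <= phi x + (2 * r)%:R * L * e.
  move=> x y e Kx Ky xy; have := H _ _ _ Kx Ky xy.
  have yx : near_window e y x by move=> j jr; rewrite distrC; apply: xy.
  by have := H _ _ _ Ky Kx yx; rewrite ler_norml => ? ?; apply/andP; split; lra.
move=> Kx Kx' xx'; have e0 : 0 <= e.
  by apply: le_trans (normr_ge0 _) (xx' 0 _); lia.
rewrite -lerBlDr; apply: le_phi => // y k Ky yx; rewrite lerBlDr.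
pose y' : int -> R := fun j => if - r%:Z <= j then x' j else y j.
have Ky' : between y' by move=> j; rewrite /y'; case: ifP.
have y'x' j : - r%:Z <= j -> y' j = x' j by rewrite /y' => ->.
apply: le_trans (phi_le k Ky' y'x') _.
rewrite addrC -lerBlDr /back -sumrB -mulrA.
apply: (@sum_le_initial (fun l => h (shift (- l.+1%:Z) y') -
    h (shift (- l.+1%:Z) y))) => [|l|l Ml]; first exact: mulr_ge0.
  apply: le_trans (ler_norm _) _.
  apply: h_lip; try exact: between_shift.
  move=> j jr; rewrite /shift /y'; case: ifP => [rj|_].
    by rewrite yx // distrC; apply: xx'; lia.
  by rewrite subrr normr0.
rewrite (_ : h _ = h (shift (- l.+1%:Z) y)) ?subrr //.
apply: h_local; try exact: between_shift.
by move=> j jr; rewrite /shift /y'; case: ifP => // rj; exfalso; lia.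
Qed.

Definition seg x p k : R := \sum_(l < k) h (shift (p + l%:Z) x).

(** The energy of a stretch after correction at its ends; by phi_step it is a sum
    of nonnegative contributions of the sites. *)
Definition excess x p k : R := seg x p k - phi (shift (p + k%:Z) x) + phi (shift p x).

Lemma segS x p k : seg x p k.+1 = seg x p k + h (shift (p + k%:Z) x).
Proof. by rewrite /seg big_ord_recr. Qed.

Lemma segSl x p k : seg x p k.+1 = h (shift p x) + seg x (p + 1) k.
Proof.
rewrite /seg big_ord_recl /= addr0; congr (_ + _).
by apply: eq_bigr => i _; congr h; apply: eq_shift; rewrite /bump /=; lia.
Qed.

Lemma seg_shift x t p k : seg (shift t x) p k = seg x (p + t) k.
Proof. by apply: eq_bigr => i _; rewrite shiftD; congr h; apply: eq_shift; lia. Qed.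

Lemma excess_shift x t p k : excess (shift t x) p k = excess x (p + t) k.
Proof.
rewrite /excess seg_shift !shiftD; by rewrite (addrAC p).
Qed.

Lemma excess0 x p : excess x p 0 = 0.
Proof. by rewrite /excess /seg big_ord0 addr0 add0r addNr. Qed.

Lemma excess_right x p k j : between x -> excess x p k <= excess x p (k + j).
Proof.
move=> Kx; elim: j => [|j IH]; first by rewrite addn0.
apply: le_trans IH _; rewrite addnS /excess segS.
have := phi_step (between_shift (p + (k + j)%N%:Z) Kx).
rewrite shiftD (_ : 1 + (p + (k + j)%N%:Z) = p + (k + j).+1%:Z); last lia.
lra.
Qed.

Lemma excess_left x p k j : between x ->
  excess x p k <= excess x (p - j%:Z) (k + j).
Proof.
move=> Kx; elim: j => [|j IH]; first by rewrite addn0 subr0.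
apply: le_trans IH _; rewrite addnS /excess segSl.
have := phi_step (between_shift (p - j.+1%:Z) Kx).
rewrite shiftD.
rewrite (_ : 1 + (p - j.+1%:Z) = p - j%:Z); last lia.
rewrite (_ : p - j.+1%:Z + 1 = p - j%:Z); last lia.
rewrite (_ : p - j.+1%:Z + (k + j).+1%:Z = p - j%:Z + (k + j)%N%:Z); last lia.
lra.
Qed.

Lemma excess_ge0 x p k : between x -> 0 <= excess x p k.
Proof. by move=> Kx; rewrite -(excess0 x p); have := excess_right p 0 k Kx. Qed.

Lemma excess_sub x p k p' k' : between x -> p' <= p ->
  p + k%:Z <= p' + k'%:Z -> excess x p k <= excess x p' k'.
Proof.
move=> Kx pp' pk; have := excess_left p k `|p - p'|%N Kx.
move/le_trans; apply.
have -> : p - `|p - p'|%N%:Z = p' by lia.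
have := excess_right p' (k + `|p - p'|) (k' - (k + `|p - p'|)) Kx.
by rewrite subnKC //; lia.
Qed.

Lemma seg_ge x p k : between x -> - floor_const <= seg x p k.
Proof.
move=> Kx; have := excess_ge0 p k Kx; rewrite /excess.
have := phi_le0 (between_shift p Kx).
have := phi_ge (between_shift (p + k%:Z) Kx); lra.
Qed.

Lemma seg_le_excess x p k : between x -> seg x p k <= excess x p k + floor_const.
Proof.
move=> Kx; rewrite /excess.
have := phi_ge (between_shift p Kx).
have := phi_le0 (between_shift (p + k%:Z) Kx); lra.
Qed.

Lemma excess_le_seg x p k : between x -> excess x p k <= seg x p k + floor_const.
Proof.
move=> Kx; rewrite /excess.
have := phi_le0 (between_shift p Kx).
have := phi_ge (between_shift (p + k%:Z) Kx); lra.
Qed.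


(** * Energy of sequences that join a to b *)

Definition hetero x : Prop := [/\ between x,
  x (- m%:Z) @[m --> \oo] --> a & x m%:Z @[m --> \oo] --> b].

Definition sym_sum x N : R := seg x (- N%:Z) (2 * N).+1.

(** Symmetric partial sums suffice: for a sequence joining a to b the sums over
    all intervals have the same limit, see seg_cvg. *)
Definition has_energy x (c : R) : Prop := sym_sum x N @[N --> \oo] --> c.

Definition sym_excess x N : R := excess x (- N%:Z) (2 * N).+1.

Definition phi_jump : R := phi (fun=> b) - phi (fun=> a).

Lemma window_lipschitz_cvg C f (X : nat -> int -> R) c : 0 <= C ->
  window_lipschitz C f -> (forall N, between (X N)) -> a <= c <= b ->
  (forall e, 0 < e -> exists M : nat, forall N, (M <= N)%N ->
     near_window e (X N) (fun=> c)) ->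
  f (X N) @[N --> \oo] --> f (fun=> c).
Proof.
move=> C0 flip KX abc Xc; apply/cvgrPdist_le => e e0.
have [M HM] := Xc (e / (C + 1)) (divr_gt0 e0 (ltr_wpDl C0 ltr01)).
exists M => // N /= MN; rewrite distrC.
apply: le_trans (flip _ _ _ (KX N) (between_cst abc) (HM N MN)) _.
by rewrite mulrCA ger_pMr // ler_pdivrMr ?ltr_wpDl // mul1r lerDl.
Qed.

Lemma in_ab_a : a <= a <= b. Proof. by rewrite lexx. Qed.
Lemma in_ab_b : a <= b <= b. Proof. by rewrite lexx andbT. Qed.
Hint Resolve in_ab_a in_ab_b : core.

Lemma cvg_far (u : nat -> R) c e : u m @[m --> \oo] --> c -> 0 < e ->
  exists M : nat, forall m, (M <= m)%N -> `|u m - c| <= e.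
Proof.
move=> /cvgrPdist_le H e0; have [M _ HM] := H e e0.
by exists M => m Mm; rewrite distrC; apply: HM.
Qed.

Lemma tail_right C f x c (d : int) : 0 <= C -> window_lipschitz C f -> between x ->
  a <= c <= b -> x m%:Z @[m --> \oo] --> c ->
  f (shift (N%:Z + d) x) @[N --> \oo] --> f (fun=> c).
Proof.
move=> C0 flip Kx abc xc; apply: (window_lipschitz_cvg C0 flip) => //.
  by move=> N; apply: between_shift.
move=> e /(cvg_far xc)[M HM]; exists (M + r + absz d)%N => N MN j jr.
rewrite /shift; have -> : j + (N%:Z + d) = (absz (j + (N%:Z + d)))%:Z by lia.
by apply: HM; lia.
Qed.

Lemma tail_left C f x c (d : int) : 0 <= C -> window_lipschitz C f -> between x ->
  a <= c <= b -> x (- m%:Z) @[m --> \oo] --> c ->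
  f (shift (- N%:Z + d) x) @[N --> \oo] --> f (fun=> c).
Proof.
move=> C0 flip Kx abc xc; apply: (window_lipschitz_cvg C0 flip) => //.
  by move=> N; apply: between_shift.
move=> e /(cvg_far xc)[M HM]; exists (M + r + absz d)%N => N MN j jr.
rewrite /shift; have -> : j + (- N%:Z + d) = - (absz (j + (- N%:Z + d)))%:Z by lia.
by apply: HM; lia.
Qed.

Lemma phi_const_ge0 : 0 <= (2 * r)%:R * L.
Proof. exact: mulr_ge0. Qed.

Lemma phi_left x d : between x -> x (- m%:Z) @[m --> \oo] --> a ->
  phi (shift (- N%:Z + d) x) @[N --> \oo] --> phi (fun=> a).
Proof. by move=> Kx; exact: (tail_left _ phi_const_ge0 phi_lip Kx in_ab_a). Qed.

Lemma phi_right x d : between x -> x m%:Z @[m --> \oo] --> b ->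
  phi (shift (N%:Z + d) x) @[N --> \oo] --> phi (fun=> b).
Proof. by move=> Kx; exact: (tail_right _ phi_const_ge0 phi_lip Kx in_ab_b). Qed.

Lemma sym_excess_nondecreasing x : between x ->
  nondecreasing_seq (sym_excess x).
Proof. by move=> Kx m n mn; apply: excess_sub => //; lia. Qed.

Lemma phi_ends_cvg x : hetero x ->
  phi (shift (N%:Z + 1) x) - phi (shift (- N%:Z + 0) x) @[N --> \oo] --> phi_jump.
Proof. by case=> Kx xa xb; apply: cvgB; [apply: phi_right|apply: phi_left]. Qed.

Lemma sym_sumE x N : sym_sum x N =
  sym_excess x N + (phi (shift (N%:Z + 1) x) - phi (shift (- N%:Z + 0) x)).
Proof.
rewrite /sym_sum /sym_excess /excess addr0.
rewrite (_ : - N%:Z + (2 * N).+1%:Z = N%:Z + 1); [ring|lia].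
Qed.

Lemma energy_excessP x c : hetero x ->
  has_energy x c <-> sym_excess x N @[N --> \oo] --> c - phi_jump.
Proof.
move=> Gx; have pc := phi_ends_cvg Gx; split => [Ec|Tc].
  have -> : sym_excess x = (fun N => sym_sum x N -
      (phi (shift (N%:Z + 1) x) - phi (shift (- N%:Z + 0) x))).
    by apply/funext => N; rewrite sym_sumE addrK.
  exact: cvgB.
rewrite /has_energy (_ : sym_sum x = (fun N => sym_excess x N +
    (phi (shift (N%:Z + 1) x) - phi (shift (- N%:Z + 0) x)))).
  by rewrite -[c](subrK phi_jump); apply: cvgD.
by apply/funext => N; rewrite sym_sumE.
Qed.

Lemma excess_le_energy x c p k : hetero x -> has_energy x c ->
  excess x p k <= c - phi_jump.
Proof.
move=> Gx Ec; have [Kx _ _] := Gx.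
have /(energy_excessP _ Gx) Tc := Ec.
have := nondecreasing_cvgn_le (sym_excess_nondecreasing Kx).
move=> /(_ (cvgP _ Tc) (absz p + k)%N); rewrite (cvg_lim _ Tc) //.
by apply: le_trans; apply: excess_sub => //; lia.
Qed.

(** The corrected partial sums are nondecreasing, so that boundedness gives
    convergence. *)
Lemma energy_exists x C : hetero x ->
  (forall N, sym_excess x N <= C) ->
  exists2 c, has_energy x c & c <= C + phi_jump.
Proof.
move=> Gx TC; have [Kx _ _] := Gx.
have cv : cvgn (sym_excess x).
  apply: nondecreasing_is_cvgn (sym_excess_nondecreasing Kx) _.
  by exists C => _ [N _ <-].
exists (limn (sym_excess x) + phi_jump).
  by apply/(energy_excessP _ Gx); rewrite addrK.
by rewrite lerD2r; apply: limr_le => //; apply: nearW.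
Qed.

Lemma energy_unique x c c' : has_energy x c -> has_energy x c' -> c = c'.
Proof. by move=> xc xc'; apply: (cvg_unique _ xc xc'). Qed.

Lemma energy_ge x c : hetero x -> has_energy x c -> phi_jump <= c.
Proof.
move=> Gx Ec; have := excess_le_energy 0 0 Gx Ec.
by rewrite excess0 subr_ge0.
Qed.

Lemma hetero_shift x t : hetero x -> hetero (shift t x).
Proof.
case=> Kx xa xb; split; first exact: between_shift.
- apply/cvgrPdist_le => e /(cvg_far xa)[M HM]; exists (M + absz t)%N => // N /= MN.
  rewrite distrC /shift (_ : - N%:Z + t = - (absz (- N%:Z + t))%:Z); last lia.
  by apply: HM; lia.
- apply/cvgrPdist_le => e /(cvg_far xb)[M HM]; exists (M + absz t)%N => // N /= MN.
  rewrite distrC /shift (_ : N%:Z + t = (absz (N%:Z + t))%:Z); last lia.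
  by apply: HM; lia.
Qed.

(** The corrected sums of the shift are those of x over other intervals, which
    gives one inequality; the opposite shift gives the other. *)
Lemma energy_shift x t c : hetero x -> has_energy x c ->
  has_energy (shift t x) c.
Proof.
have H y t' c' : hetero y -> has_energy y c' ->
    exists2 c'', has_energy (shift t' y) c'' & c'' <= c'.
  move=> Gy Ec; have [|c'' Ec'' le] :=
      @energy_exists (shift t' y) (c' - phi_jump) (hetero_shift _ Gy).
    by move=> N; rewrite /sym_excess excess_shift; apply: excess_le_energy.
  by exists c'' => //; rewrite subrK in le.
move=> Gx Ec; have [c' Ec' c'c] := H _ t _ Gx Ec.
have [c'' Ec'' c''c'] := H _ (- t) _ (hetero_shift t Gx) Ec'.
move: Ec''; rewrite shiftD addNr shift0 => /(energy_unique Ec) cc.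
suff -> : c = c' by [].
by apply/eqP; rewrite eq_le c'c {1}cc c''c'.
Qed.

Lemma cvg_either (u v w : nat -> R) (c : R) : u m @[m --> \oo] --> c ->
  v m @[m --> \oo] --> c -> (forall m, w m = u m \/ w m = v m) ->
  w m @[m --> \oo] --> c.
Proof.
move=> uc vc wuv; apply/cvgrPdist_le => e e0.
have [M HM] := cvg_far uc e0; have [M' HM'] := cvg_far vc e0.
exists (M + M')%N => // m /= Mm; rewrite distrC.
by have [->|->] := wuv m; [apply: HM|apply: HM']; lia.
Qed.

Lemma hetero_either x y z : hetero x -> hetero y ->
  (forall t, z t = x t \/ z t = y t) -> hetero z.
Proof.
move=> [Kx xa xb] [Ky ya yb] zxy; split.
- by move=> t; have [->|->] := zxy t.
- by apply: (cvg_either xa ya) => m.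
- by apply: (cvg_either xb yb) => m.
Qed.

Lemma fmin_either x y t : fmin x y t = x t \/ fmin x y t = y t.
Proof. by rewrite /fmin; case: leP; [left|right]. Qed.

Lemma fmax_either x y t : fmax x y t = x t \/ fmax x y t = y t.
Proof. by rewrite /fmax; case: leP; [right|left]. Qed.

Lemma sym_sum_bounds x c N : hetero x -> has_energy x c ->
  sym_sum x N <= c - phi_jump + floor_const.
Proof.
move=> Gx Ec; have [Kx _ _] := Gx; apply: le_trans (seg_le_excess _ _ Kx) _.
by rewrite lerD2r; apply: excess_le_energy.
Qed.

Lemma energy_bounded x C : hetero x -> (forall N, sym_sum x N <= C) ->
  exists c, has_energy x c.
Proof.
move=> Gx SC; have [Kx _ _] := Gx.
have [|c Ec _] := @energy_exists x (C + floor_const) Gx; last by exists c.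
by move=> N; apply: le_trans (excess_le_seg _ _ Kx) _; rewrite lerD2r; apply: SC.
Qed.

Lemma cvg_sum_seq (I : Type) (l : seq I) (F : set_system nat)
    (u : I -> nat -> R) (e : I -> R) : Filter F ->
  (forall k : I, u k N @[N --> F] --> e k) ->
  \sum_(k <- l) u k N @[N --> F] --> \sum_(k <- l) e k.
Proof.
move=> FF ue; elim: l => [|k l IH].
  rewrite big_nil; under eq_fun do rewrite big_nil; exact: cvg_cst.
by rewrite big_cons; under eq_fun do rewrite big_cons; apply: cvgD.
Qed.

(** Finite stretches compare site by site.  As they are bounded below, an upper
    bound on the sum over the family bounds each member, so the energies of the
    members of the smaller family exist. *)
Lemma energy_sum_le (P Q : nat) (X Y : nat -> int -> R) (e : nat -> R) :
  (forall k, (k < P)%N -> hetero (X k)) ->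
  (forall k, (k < Q)%N -> hetero (Y k)) ->
  (forall k, (k < Q)%N -> has_energy (Y k) (e k)) ->
  (forall t, \sum_(k < P) h (shift t (X k)) <= \sum_(k < Q) h (shift t (Y k))) ->
  exists2 f : nat -> R, (forall k, (k < P)%N -> has_energy (X k) (f k)) &
    \sum_(k < P) f k <= \sum_(k < Q) e k.
Proof.
move=> GX GY EY XY.
have SXY N : \sum_(k < P) sym_sum (X k) N <= \sum_(k < Q) sym_sum (Y k) N.
  rewrite /sym_sum /seg exchange_big [leRHS]exchange_big /=.
  by apply: ler_sum => l _; apply: XY.
pose C := \sum_(k < Q) (e k - phi_jump + floor_const).
have SYC N : \sum_(k < Q) sym_sum (Y k) N <= C.
  by apply: ler_sum => k _; apply: sym_sum_bounds; [apply: GY|apply: EY].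
have EX k : exists f, (k < P)%N -> has_energy (X k) f.
  case: (ltnP k P) => [kP|_]; last by exists 0.
  have [|c Ec] := @energy_bounded (X k) (C + P%:R * floor_const) (GX k kP); last first.
    by exists c.
  move=> N; have := le_trans (SXY N) (SYC N).
  move=> SC; have : \sum_(i < P) (sym_sum (X i) N + floor_const) <=
      C + P%:R * floor_const.
    by rewrite big_split /= sumr_const card_ord mulr_natl lerD2r.
  apply: le_trans; rewrite (bigD1 (Ordinal kP)) //= -addrA ler_wpDr //.
  rewrite addr_ge0 ?floor_const_ge0 // sumr_ge0 // => i _.
  by rewrite -lerBlDr sub0r; apply: seg_ge; have [] := GX i (ltn_ord i).
have [f Hf] := choice EX.
exists f => [k kP|]; first exact: Hf.
have c1 : \sum_(k < P) sym_sum (X k) N @[N --> \oo] --> \sum_(k < P) f k.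
  by apply: cvg_sum_seq => k; apply: Hf.
have c2 : \sum_(k < Q) sym_sum (Y k) N @[N --> \oo] --> \sum_(k < Q) e k.
  by apply: cvg_sum_seq => k; apply: EY.
by apply: (ler_cvg_to c1 c2); apply: nearW.
Qed.

Lemma energy_fmin_fmax x y c c' : hetero x -> hetero y ->
  has_energy x c -> has_energy y c' ->
  exists d d', [/\ has_energy (fmin x y) d, has_energy (fmax x y) d' &
    d + d' <= c + c'].
Proof.
move=> Gx Gy Ec Ec'.
have [k _|k _|k _|t|f Hf] := @energy_sum_le 2 2
    (fun k => if k == 0%N then fmin x y else fmax x y)
    (fun k => if k == 0%N then x else y) (fun k => if k == 0%N then c else c').
- by case: ifP => _; apply: (hetero_either Gx Gy) => t;
    [apply: fmin_either|apply: fmax_either].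
- by case: ifP.
- by case: ifP.
- by rewrite !big_ord_recl !big_ord0 /= !addr0; apply: h_sub.
rewrite !big_ord_recl !big_ord0 /= !addr0 => le.
by exists (f 0%N), (f 1%N); split=> //; [apply: (Hf 0%N)|apply: (Hf 1%N)].
Qed.

(** * Existence of a minimizer *)

Definition trunc x N : int -> R :=
  fun j => if j < - N%:Z then a else if N%:Z < j then b else x j.

Lemma trunc_between x N : between x -> between (trunc x N).
Proof. by move=> Kx t; rewrite /trunc; case: ifP => // _; case: ifP. Qed.

Lemma trunc_hetero x N : between x -> hetero (trunc x N).
Proof.
move=> Kx; split; first exact: trunc_between.
- apply/cvgrPdist_le => e e0; exists N.+1 => // m /= mN.
  by rewrite /trunc ifT ?subrr ?normr0 ?ltW //; lia.
- apply/cvgrPdist_le => e e0; exists N.+1 => // m /= mN.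
  by rewrite /trunc ifF ?ifT ?subrr ?normr0 ?ltW //; lia.
Qed.

Lemma sym_sumD x N k : sym_sum x (N + k) = sym_sum x N +
  \sum_(l < k) (h (shift (- N%:Z + - l.+1%:Z) x) + h (shift (N%:Z + l.+1%:Z) x)).
Proof.
elim: k => [|k IH]; first by rewrite addn0 big_ord0 addr0.
rewrite big_ord_recr /= [RHS]addrA -IH addnS /sym_sum.
rewrite (_ : (2 * (N + k).+1).+1 = ((2 * (N + k)).+1).+2); last lia.
rewrite segS segSl.
rewrite (_ : - (N + k).+1%:Z + 1 = - (N + k)%N%:Z); last lia.
rewrite (_ : - (N + k).+1%:Z + (2 * (N + k)).+2%:Z = N%:Z + k.+1%:Z); last lia.
rewrite (_ : - (N + k).+1%:Z = - N%:Z + - k.+1%:Z); [ring|lia].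
Qed.

Lemma trunc_energy x N : between x ->
  has_energy (trunc x N) (sym_sum (trunc x N) (N + r)).
Proof.
move=> Kx; apply/cvgrPdist_le => e e0; exists (N + r)%N => // m /= mN.
rewrite -(subnKC mN) [X in _ - X]sym_sumD opprD addrA subrr sub0r normrN.
rewrite big1 ?normr0 ?ltW // => l _.
have Kt := trunc_between N Kx.
have -> : h (shift (- (N + r)%N%:Z + - l.+1%:Z) (trunc x N)) = 0.
  rewrite -h_a; apply: h_local; [exact: between_shift|exact: between_cst|].
  by move=> j jr; rewrite /shift /trunc ifT //; lia.
rewrite add0r -h_b; apply: h_local; [exact: between_shift|exact: between_cst|].
by move=> j jr; rewrite /shift /trunc ifF ?ifT //; lia.
Qed.

(** Near the ends of the truncation all windows are close to the constants a or
    b, where h vanishes. *)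
Lemma trunc_energy_cvg x c : hetero x -> has_energy x c ->
  sym_sum (trunc x (N + r)) (N + r + r) @[N --> \oo] --> c.
Proof.
move=> [Kx xa xb] Ec; under eq_fun do rewrite -addnA sym_sumD.
rewrite -[c]addr0; apply: cvgD.
  suff -> : (fun N => sym_sum (trunc x (N + r)) N) = sym_sum x by [].
  apply/funext => N; apply: eq_bigr => l _.
  apply: h_local; try exact: between_shift; first exact/between_shift/trunc_between.
  move=> j jr; rewrite /shift /trunc ifF ?ifF //; have := ltn_ord l; lia.
rewrite [X in _ --> X](_ : 0 = \sum_(l < r + r) (h (fun=> a) + h (fun=> b))); last first.
  by rewrite h_a h_b addr0 sumr_const mul0rn.
apply: cvg_sum_seq => l; apply: cvgD.
- apply: (@window_lipschitz_cvg L h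
    (fun N => shift (- N%:Z + - l.+1%:Z) (trunc x (N + r)))) => //.
    by move=> N; apply/between_shift/trunc_between.
  move=> e e0; have [M HM] := cvg_far xa e0.
  exists (M + r)%N => N MN j jr; rewrite /shift /trunc.
  case: ifP => _; first by rewrite subrr normr0 ltW.
  rewrite ifF; last by apply/negbTE; lia.
  set t := j + _; have -> : t = - (absz t)%:Z by rewrite /t; lia.
  by apply: HM; rewrite /t; lia.
- apply: (@window_lipschitz_cvg L h
    (fun N => shift (N%:Z + l.+1%:Z) (trunc x (N + r)))) => //.
    by move=> N; apply/between_shift/trunc_between.
  move=> e e0; have [M HM] := cvg_far xb e0.
  exists (M + r)%N => N MN j jr; rewrite /shift /trunc.
  rewrite ifF; last by apply/negbTE; lia.
  case: ifP => _; first by rewrite subrr normr0 ltW.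
  set t := j + _; have -> : t = (absz t)%:Z by rewrite /t; lia.
  by apply: HM; rewrite /t; lia.
Qed.

Definition monotone x : Prop := forall t, x t <= x (t + 1).

Lemma hetero_ostat x P k : (k < P)%N -> hetero x -> hetero (ostat x P k).
Proof.
move=> kP [Kx xa xb]; split.
- by move=> t; have [i _ ->] := ostat_mem x t kP.
- apply/cvgrPdist_le => e /(cvg_far xa)[M HM]; exists (M + P)%N => // m /= mP.
  have [i iP ->] := ostat_mem x (- m%:Z) kP; rewrite distrC.
  by rewrite (_ : - m%:Z + i%:Z = - (m - i)%N%:Z); [apply: HM|]; lia.
- apply/cvgrPdist_le => e /(cvg_far xb)[M HM]; exists M => // m /= mP.
  have [i iP ->] := ostat_mem x m%:Z kP; rewrite distrC.
  by rewrite -PoszD; apply: HM; lia.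
Qed.

(** If the transition of y takes place in [-N, N], then 2N+1 consecutive values of
    y start with a or are followed by b; hence y t <= y (t + 2N + 1), and the
    order statistics are monotone. *)
Lemma monotone_energy x c e : hetero x -> has_energy x c -> 0 < e ->
  exists z c', [/\ hetero z, monotone z, has_energy z c' & c' <= c + e].
Proof.
move=> Gx Ec e0; have [Kx _ _] := Gx.
have [N0 HN] := cvg_far (trunc_energy_cvg Gx Ec) e0.
have := HN N0 (leqnn _); set N := (N0 + r)%N; set y := trunc x N.
have := trunc_energy (N := N) Kx; rewrite -/y.
set d := sym_sum y _ => Ey dc; have Gy : hetero y by apply: trunc_hetero.
pose P := (2 * N).+1.
have yP t : y t <= y (t + P%:Z).
  have Ky : between y by apply: trunc_between.
  rewrite {1}/y /trunc; case: ifP => tN.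
    by have /andP[] := Ky (t + P%:Z).
  have -> : y (t + P%:Z) = b by rewrite /y /trunc ifF ?ifT // /P; lia.
  by case: ifP => // _; case/andP: (Kx t).
have [k kP|k kP|k kP|t|f Ef fd] := @energy_sum_le P P (ostat y P)
   (fun k => shift k%:Z y) (fun=> d).
- exact: hetero_ostat.
- exact: hetero_shift.
- exact: energy_shift.
- under eq_bigr do rewrite shift_ostat.
  under [leRHS]eq_bigr do rewrite shiftD addrC -shiftD.
  exact: submodular_ostat.
have [k kP fk] : exists2 k, (k < P)%N & f k <= d.
  apply: contrapT => H; move: fd; apply/negP; rewrite -ltNge.
  apply: ltr_sum; first by apply/hasP; exists ord0; rewrite ?mem_index_enum.
  move=> i _; rewrite ltNge; apply/negP => fi; apply: H.
  by exists i.
exists (ostat y P k), (f k); split.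
- exact: hetero_ostat.
- by move=> t; apply: ostat_monotone.
- exact: Ef.
- apply: le_trans fk _.
  by move: dc; rewrite ler_norml => /andP[_]; lra.
Qed.

Lemma ultra_bounded_cvg (G : set_system nat) (u : nat -> R) :
  UltraFilter G -> (forall n, a <= u n <= b) ->
  exists2 p : R, a <= p <= b & u n @[n --> G] --> p.
Proof.
move=> UG uab; have GF : ProperFilter G by apply: ultra_proper.
have [|p [pab cl]] := @segment_compact R a b (u @ G) (fmap_proper_filter u GF).
  by apply: (@filterS _ G _ setT) => [n _ /=|]; [rewrite in_itv /= uab|exact: filterT].
exists p; first by move: pab; rewrite /= in_itv.
move=> A pA; have [//|GA] := in_ultra_setVsetC (u @^-1` A) UG.
by have [y [? ?]] := cl (~` A) A GA pA.
Qed.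

(** A window has finitely many sites, so pointwise convergence is uniform on it. *)
Lemma window_lipschitz_filter C f (G : set_system nat) (X : nat -> int -> R) x :
  Filter G -> 0 <= C -> window_lipschitz C f ->
  (forall n, between (X n)) -> between x ->
  (forall i, X n i @[n --> G] --> x i) ->
  f (X n) @[n --> G] --> f x.
Proof.
move=> FG C0 flip KX Kx Xx; apply/cvgrPdist_le => e e0.
have e'0 : 0 < e / (C + 1) by rewrite divr_gt0 // ltr_wpDl.
have near k : \forall n \near G, forall j : int, - r%:Z <= j < - r%:Z + k%:Z ->
    `|x j - X n j| <= e / (C + 1).
  elim: k => [|k IH]; first by apply: nearW => n j; lia.
  have /cvgrPdist_le /(_ _ e'0) Hk := Xx (- r%:Z + k%:Z).
  apply: filterS (filterI IH Hk) => n [H1 H2] j jk.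
  by have [->//|jk'] := eqVneq j (- r%:Z + k%:Z); apply: H1; lia.
apply: filterS (near (2 * r).+1) => n Hn.
apply: le_trans (flip _ _ (e / (C + 1)) Kx (KX n) _) _.
  by move=> j jr; apply: Hn; lia.
by rewrite mulrCA ger_pMr // ler_pdivrMr ?ltr_wpDl // mul1r lerDl.
Qed.

Lemma monotone_le x s t : monotone x -> s <= t -> x s <= x t.
Proof.
move=> mx st; have -> : t = s + (absz (t - s))%:Z by lia.
elim: (absz _) => [|n IH]; first by rewrite addr0.
apply: le_trans IH _; rewrite (_ : s + n.+1%:Z = s + n%:Z + 1) ?mx //; lia.
Qed.

(** This fixes the translate of a minimizing sequence, so that its limit cannot
    be one of the constants a and b. *)
Lemma monotone_cross x m : a < m < b -> hetero x -> monotone x ->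
  exists t, x (t - 1) <= m <= x t.
Proof.
move=> /andP[am mb] [Kx xa xb] mx.
have [M HM] : exists M : nat, x (- M%:Z) < m.
  have e0 : 0 < (m - a) / 2 by lra.
  have [M HM] := cvg_far xa e0; exists M.
  by have := HM M (leqnn _); rewrite ler_norml => /andP[_]; lra.
have exn : exists n : nat, m <= x (- M%:Z + n%:Z).
  have e0 : 0 < (b - m) / 2 by lra.
  have [M' HM'] := cvg_far xb e0; exists (M + M')%N.
  have := HM' M' (leqnn _); rewrite (_ : - M%:Z + _ = M'%:Z); last lia.
  by rewrite ler_norml => /andP[+ _]; lra.
case: (ex_minnP exn) => -[|n] mn min; first by move: mn; rewrite addr0; lra.
exists (- M%:Z + n.+1%:Z); rewrite mn andbT.
rewrite (_ : _ - 1 = - M%:Z + n%:Z); last lia.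
by rewrite leNgt; apply/negP => /ltW /min; rewrite ltnn.
Qed.

Hypothesis h_zero : forall c, a <= c <= b -> h (fun=> c) = 0 -> c = a \/ c = b.

(** The contribution of the site k to the excess tends to h c, and to 0 because
    the excess stays bounded. *)
Lemma excess_bounded_right x c C : between x -> a <= c <= b ->
  (forall p k, excess x p k <= C) -> x m%:Z @[m --> \oo] --> c ->
  h (fun=> c) = 0.
Proof.
move=> Kx abc bnd xc.
have cv : cvgn (excess x 0).
  apply: nondecreasing_is_cvgn; last by exists C => _ [N _ <-].
  by move=> m n mn; apply: excess_sub => //; lia.
have c1 : excess x 0 k.+1 - excess x 0 k @[k --> \oo] --> (0 : R).
  rewrite -(subrr (limn (excess x 0))); apply: cvgB => //.
  by have := cv; rewrite -(cvg_shiftS (excess x 0)).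
have c2 : excess x 0 k.+1 - excess x 0 k @[k --> \oo] --> h (fun=> c).
  have -> : (fun k => excess x 0 k.+1 - excess x 0 k) = (fun k : nat =>
     h (shift (k%:Z + 0) x) - phi (shift (k%:Z + 1) x) + phi (shift (k%:Z + 0) x)).
    apply/funext => k; rewrite /excess segS !add0r addr0.
    rewrite (_ : k.+1%:Z = k%:Z + 1); [ring|lia].
  rewrite -[h _](subrK (phi (fun=> c))); apply: cvgD; first apply: cvgB.
  - exact: (tail_right _ L_ge0 h_lip Kx abc).
  - exact: (tail_right _ phi_const_ge0 phi_lip Kx abc).
  - exact: (tail_right _ phi_const_ge0 phi_lip Kx abc).
exact: (cvg_unique _ c2 c1).
Qed.

Lemma excess_bounded_left x c C : between x -> a <= c <= b ->
  (forall p k, excess x p k <= C) -> x (- m%:Z) @[m --> \oo] --> c ->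
  h (fun=> c) = 0.
Proof.
move=> Kx abc bnd xc; pose u (k : nat) := excess x (- k%:Z) k.
have cv : cvgn u.
  apply: nondecreasing_is_cvgn; last by exists C => _ [N _ <-]; apply: bnd.
  by move=> m n mn; apply: excess_sub => //; lia.
have c1 : u k.+1 - u k @[k --> \oo] --> (0 : R).
  rewrite -(subrr (limn u)); apply: cvgB => //.
  by have := cv; rewrite -(cvg_shiftS u).
have c2 : u k.+1 - u k @[k --> \oo] --> h (fun=> c).
  have -> : (fun k => u k.+1 - u k) = (fun k : nat =>
     h (shift (- k%:Z + - 1) x) - phi (shift (- k%:Z + 0) x) +
     phi (shift (- k%:Z + - 1) x)).
    apply/funext => k; rewrite /u /excess segSl addr0.
    rewrite (_ : - k.+1%:Z + k.+1%:Z = 0); last lia.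
    rewrite (_ : - k.+1%:Z + 1 = - k%:Z); last lia.
    rewrite (_ : - k.+1%:Z = - k%:Z + - 1); last lia.
    rewrite (addNr k%:Z); ring.
  rewrite -[h _](subrK (phi (fun=> c))); apply: cvgD; first apply: cvgB.
  - exact: (tail_left _ L_ge0 h_lip Kx abc).
  - exact: (tail_left _ phi_const_ge0 phi_lip Kx abc).
  - exact: (tail_left _ phi_const_ge0 phi_lip Kx abc).
exact: (cvg_unique _ c2 c1).
Qed.

Lemma monotone_limits x C m : a < m < b -> between x -> monotone x ->
  (forall p k, excess x p k <= C) -> x (- 1) <= m <= x 0 -> hetero x.
Proof.
move=> /andP[am mb] Kx mx bnd /andP[xm mx0].
have [cr abr xr] : exists2 c, m <= c <= b & x m%:Z @[m --> \oo] --> c.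
  have cv : cvgn (fun n : nat => x n%:Z).
    apply: nondecreasing_is_cvgn.
      by move=> i j ij; apply: monotone_le => //; lia.
    by exists b => _ [N _ <-]; case/andP: (Kx N%:Z).
  exists (limn (fun n : nat => x n%:Z)) => //; apply/andP; split.
    apply: limr_ge => //; apply: nearW => n; apply: le_trans mx0 _.
    by apply: monotone_le.
  by apply: limr_le => //; apply: nearW => n; case/andP: (Kx n%:Z).
have [cl abl xl] : exists2 c, a <= c <= m & x (- m%:Z) @[m --> \oo] --> c.
  have cv : cvgn (fun n : nat => x (- n%:Z)).
    apply: nonincreasing_is_cvgn.
      by move=> i j ij; apply: monotone_le => //; lia.
    by exists a => _ [N _ <-]; case/andP: (Kx (- N%:Z)).
  exists (limn (fun n : nat => x (- n%:Z))) => //; apply/andP; split.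
    by apply: limr_ge => //; apply: nearW => n; case/andP: (Kx (- n%:Z)).
  apply: limr_le => //; exists 1%N => // n /= n1; apply: le_trans xm.
  by apply: monotone_le => //; lia.
split => //.
- have cab : a <= cl <= b by lra.
  have [|cla|clb] := h_zero cab; last by move: abl; lra.
    exact: (excess_bounded_left Kx cab bnd xl).
  by rewrite -[X in _ --> X]cla.
- have cab : a <= cr <= b by lra.
  have [|cra|crb] := h_zero cab; first exact: (excess_bounded_right Kx cab bnd xr).
    by move: abr; lra.
  by rewrite -[X in _ --> X]crb.
Qed.

Definition minimal x (c : R) : Prop := [/\ hetero x, has_energy x c &
  forall y c', hetero y -> has_energy y c' -> c <= c'].

Theorem minimizer_exists : a < b -> exists x c, minimal x c.
Proof.
move=> lt_ab; pose m := (a + b) / 2; have mab : a < m < b by rewrite /m; lra.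
pose E := [set c | exists x, hetero x /\ has_energy x c].
have lbE : lbound E phi_jump by move=> c [x [Gx Ec]]; apply: energy_ge Gx Ec.
have E0 : E !=set0.
  have Ka := between_cst in_ab_a; exists (sym_sum (trunc (fun=> a) 0) (0 + r)).
  exists (trunc (fun=> a) 0); split; first exact: trunc_hetero.
  exact: trunc_energy.
have infE y c' : hetero y -> has_energy y c' -> inf E <= c'.
  by move=> Gy Ey; apply: ge_inf; [exists phi_jump|exists y].
have step (n : nat) : exists z, [/\ hetero z, monotone z,
    z (- 1) <= m <= z 0 & exists2 c, has_energy z c & c <= inf E + n.+1%:R^-1].
  have e0 : 0 < n.+1%:R^-1 / 2 :> R by rewrite divr_gt0 // invr_gt0.
  have [|c [y [Gy Ey]] cE] := @inf_adherent R E _ e0; first by split => //; exists phi_jump.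
  have [z [c' [Gz mz Ez c'c]]] := monotone_energy Gy Ey e0.
  have [t zt] := monotone_cross mab Gz mz.
  exists (shift t z); split.
  - exact: hetero_shift.
  - by move=> j; rewrite /shift addrAC.
  - by rewrite /shift add0r addrC.
  - exists c'; first exact: energy_shift.
    apply: (le_trans c'c); rewrite [leRHS](_ : _ = inf E + n.+1%:R^-1 / 2 + n.+1%:R^-1 / 2).
      by rewrite lerD2r ltW.
    by rewrite -addrA -splitr.
have [Z HZ] := choice step.
(* Along an ultrafilter the bounded values converge at all sites at once. *)
have [G [UG ooG]] := @ultraFilterLemma nat \oo _.
have KZ n : between (Z n) by have [[]] := HZ n.
have lim i : exists p : R, (a <= p <= b) /\ (Z n i @[n --> G] --> p).
  by have [p pab pl] := @ultra_bounded_cvg G (Z ^~ i) UG (fun n => KZ n i); exists p.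
have [x Hx] := choice lim.
have Kx : between x by move=> i; case: (Hx i).
have Zx i : Z n i @[n --> G] --> x i by case: (Hx i).
have Zf C f t : 0 <= C -> window_lipschitz C f ->
    f (shift t (Z n)) @[n --> G] --> f (shift t x).
  move=> C0 flip; apply: (window_lipschitz_filter _ C0 flip).
  - by move=> n; apply: between_shift.
  - exact: between_shift.
  - by move=> i; apply: Zx.
have bnd p k : excess x p k <= inf E - phi_jump.
  have cv : excess (Z n) p k @[n --> G] --> excess x p k.
    apply: cvgD (Zf _ _ _ phi_const_ge0 phi_lip).
    apply: cvgB (Zf _ _ _ phi_const_ge0 phi_lip).
    by apply: cvg_sum_seq => l; apply: (Zf _ _ _ L_ge0 h_lip).
  apply/ler_addgt0Pr => e e0; apply: (cvgr_to_le cv).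
  apply: ooG; have /cvgrPdist_le /(_ e e0) [N _ HN] := @cvg_harmonic R.
  exists N => // n /= /HN; rewrite sub0r normrN => /(le_trans (ler_norm _)) ne.
  have [Gz _ _ [c Ec cE]] := HZ n.
  apply: le_trans (excess_le_energy p k Gz Ec) _.
  by rewrite addrAC lerD2r (le_trans cE) // lerD2l.
have mx : monotone x.
  by move=> t; apply: (ler_cvg_to (Zx t) (Zx (t + 1))); apply: nearW => n; case: (HZ n).
have xm : x (- 1) <= m <= x 0.
  apply/andP; split.
    by apply: (cvgr_to_le (Zx (- 1))); apply: nearW => n; case: (HZ n) => _ _ /andP[].
  by apply: (cvgr_to_ge (Zx 0)); apply: nearW => n; case: (HZ n) => _ _ /andP[].
have Gx := monotone_limits mab Kx mx bnd xm.
have [c Ec cE] := energy_exists Gx (fun N => bnd _ _).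
exists x, c; split => // y c' Gy Ey.
by apply: le_trans (infE _ _ Gy Ey); rewrite subrK in cE.
Qed.

(** * Minimizers of the energy *)

Lemma seg_cvg x c e : hetero x -> has_energy x c -> 0 < e ->
  exists M : nat, forall m q : nat, (M <= m)%N -> (M <= q)%N ->
    `|seg x (- m%:Z) (m + q).+1 - c| <= e.
Proof.
move=> Gx Ec e0; have [Kx xa xb] := Gx; have e3 : 0 < e / 3 by lra.
have /(energy_excessP _ Gx) Tc := Ec.
have [M1 H1] := cvg_far Tc e3.
have [M2 H2] := cvg_far (phi_left 0 Kx xa) e3.
have [M3 H3] := cvg_far (phi_right 1 Kx xb) e3.
exists (M1 + M2 + M3)%N => m q mM qM.
have le1 : sym_excess x M1 <= excess x (- m%:Z) (m + q).+1.
  by apply: excess_sub => //; lia.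
have le2 := excess_le_energy (- m%:Z) (m + q).+1 Gx Ec.
have m2 : (M2 <= m)%N by lia.
have q3 : (M3 <= q)%N by lia.
have := H1 _ (leqnn _); have := H2 _ m2; have := H3 _ q3; move: le1 le2.
rewrite addr0 /phi_jump [in excess _ (- m%:Z) _]/excess.
rewrite (_ : - m%:Z + (m + q).+1%:Z = q%:Z + 1); last lia.
rewrite !ler_norml => le1 le2 /andP[? ?] /andP[? ?] /andP[? ?].
by apply/andP; split; lra.
Qed.

Lemma energy_exists_frequently x C : hetero x ->
  (forall N, exists m q : nat, [/\ (N <= m)%N, (N <= q)%N &
     seg x (- m%:Z) (m + q).+1 <= C]) -> exists c, has_energy x c.
Proof.
move=> Gx H; have [Kx _ _] := Gx.
have [|c Ec _] := @energy_exists x (C + floor_const) Gx; last by exists c.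
move=> N; have [m [q [Nm Nq sC]]] := H N.
apply: (@le_trans _ _ (excess x (- m%:Z) (m + q).+1)).
  by apply: excess_sub => //; lia.
by apply: le_trans (excess_le_seg _ _ Kx) _; rewrite lerD2r.
Qed.

Lemma seg_cat x p k j : seg x p (k + j) = seg x p k + seg x (p + k%:Z) j.
Proof.
elim: j => [|j IH]; first by rewrite addn0 /seg big_ord0 addr0.
rewrite addnS !segS IH -addrA; congr (_ + (_ + _)); congr h.
by apply: eq_shift; lia.
Qed.

Lemma hetero_local x y (i : int) : hetero x -> between y ->
  (forall j, j != i -> y j = x j) -> hetero y.
Proof.
move=> [Kx xa xb] Ky yx; split => //.
- apply/cvgrPdist_le => e /(cvg_far xa)[M HM]; exists (M + (absz i).+1)%N => // m /= mM.
  by rewrite distrC yx; [apply: HM|]; lia.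
- apply/cvgrPdist_le => e /(cvg_far xb)[M HM]; exists (M + (absz i).+1)%N => // m /= mM.
  by rewrite distrC yx; [apply: HM|]; lia.
Qed.

Lemma energy_local x y (i : int) c : hetero x -> between y ->
  (forall j, j != i -> y j = x j) -> has_energy x c ->
  has_energy y (c + (seg y (i - r%:Z) (2 * r).+1 - seg x (i - r%:Z) (2 * r).+1)).
Proof.
move=> Gx Ky yx Ec; have [Kx _ _] := Gx.
set D := seg y _ _ - _; apply/cvgrPdist_le => e e0.
have [M HM] := cvg_far Ec e0.
exists (M + absz i + r)%N => // N /= MN; rewrite distrC.
suff -> : sym_sum y N = sym_sum x N + D.
  rewrite (_ : _ - _ = sym_sum x N - c); last ring.
  by apply: HM; lia.
have split3 z : sym_sum z N = seg z (- N%:Z) (absz (i - r%:Z + N%:Z)%R) +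
    (seg z (i - r%:Z) (2 * r).+1 +
     seg z (i + r%:Z + 1) (absz (N%:Z - i - r%:Z)%R)).
  rewrite /sym_sum (_ : (2 * N).+1 = (absz (i - r%:Z + N%:Z)%R + ((2 * r).+1 +
    absz (N%:Z - i - r%:Z)%R))%N); last lia.
  rewrite !seg_cat; congr (_ + (seg _ _ _ + seg _ _ _)); lia.
have same p k : (forall l : nat, (l < k)%N -> (p + l%:Z < i - r%:Z) || (i + r%:Z < p + l%:Z)) ->
    seg y p k = seg x p k.
  move=> out; apply: eq_bigr => l _; apply: h_local; try exact: between_shift.
  move=> j jr; apply: yx; have := out l (ltn_ord l); lia.
rewrite !split3 (same (- N%:Z)); last by move=> l; lia.
rewrite (same (i + r%:Z + 1)); last by move=> l; lia.
by rewrite /D; ring.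
Qed.

Lemma minimal_shift x t c : minimal x c -> minimal (shift t x) c.
Proof.
by case=> Gx Ec minc; split => //; [apply: hetero_shift|apply: energy_shift].
Qed.

(** The energies of minimum and maximum add up to at most 2c, and each is at
    least c. *)
Lemma minimal_fmax x y c : minimal x c -> minimal y c -> minimal (fmax x y) c.
Proof.
case=> Gx Ecx minc [Gy Ecy _].
have [d [d' [Ed Ed' dd']]] := energy_fmin_fmax Gx Gy Ecx Ecy.
have Gmin : hetero (fmin x y).
  by apply: (hetero_either Gx Gy) => t; apply: fmin_either.
have Gmax : hetero (fmax x y).
  by apply: (hetero_either Gx Gy) => t; apply: fmax_either.
have := minc _ _ Gmin Ed; have := minc _ _ Gmax Ed'.
move=> cd' cd; have d'c : d' = c by lra.
by split => //; rewrite -d'c.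
Qed.

Lemma minimal_local x y (i : int) c : minimal x c -> between y ->
  (forall j, j != i -> y j = x j) ->
  0 <= seg y (i - r%:Z) (2 * r).+1 - seg x (i - r%:Z) (2 * r).+1.
Proof.
case=> Gx Ec minc Ky yx.
have := minc _ _ (hetero_local Gx Ky yx) (energy_local Gx Ky yx Ec).
by rewrite lerDl.
Qed.
End chain.

(** * Functions of finitely many variables *)

Section finitely_many_variables.
Variables (R : realType) (I : eqType) (e : seq I).
Hypotheses (e_uniq : uniq e) (e_all : forall i, i \in e).
Implicit Types (f : (I -> R) -> R) (u v w : I -> R).

(** The intermediate points of the mean value theorem along a path from u to v
    that moves one coordinate at a time. *)
Definition pinched u v w : Prop :=
  forall i, Num.min (u i) (v i) <= w i <= Num.max (u i) (v i).

Lemma pinched_in u v w (a b : R) : (forall i, a <= u i <= b) ->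
  (forall i, a <= v i <= b) -> pinched u v w -> forall i, a <= w i <= b.
Proof.
move=> ua va uvw i; have := uvw i; have := ua i; have := va i.
by case: (leP (u i) (v i)) => _; lra.
Qed.

Lemma pinched_dist u v w i : pinched u v w -> `|w i - u i| <= `|v i - u i|.
Proof.
move=> /(_ i); case: (leP (u i) (v i)) => uv H.
  by rewrite !ger0_norm ?subr_ge0; lra.
by rewrite !ler0_norm ?subr_le0; lra.
Qed.

Definition upd u i (t : R) : I -> R := [eta u with i |-> t].

Lemma upd_upd u i (t t' : R) : upd (upd u i t') i t = upd u i t.
Proof. by apply/funext => j; rewrite /upd /=; case: eqP. Qed.

Lemma upd_id u i : upd u i (u i) = u.
Proof. by apply/funext => j; rewrite /upd /=; case: eqP => // ->. Qed.

Lemma upd_same u i t : upd u i t i = t.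
Proof. by rewrite /upd /= eqxx. Qed.

Lemma is_derive_upd f u i (t : R) : (forall u, has_partial i f u) ->
  is_derive t 1 (fun t => f (upd u i t)) (partial i f (upd u i t)).
Proof.
move=> fi; have gu : (fun z : R => f (upd (upd u i t) i z)) = (fun t => f (upd u i t)).
  by apply/funext => z; rewrite upd_upd.
rewrite -gu /partial upd_same derive1E; apply: derivableP.
by have := fi (upd u i t); rewrite /has_partial upd_same.
Qed.

Lemma mvt (g dg : R -> R) (x y : R) : (forall t : R, is_derive t 1 g (dg t)) ->
  exists2 t, Num.min x y <= t <= Num.max x y & g y - g x = dg t * (y - x).
Proof.
move=> gdg.
have H x' y' : x' <= y' ->
    exists2 c, x' <= c <= y' & g y' - g x' = dg c * (y' - x').
  move=> xy; have [|c cxy gxy] := @MVT_segment R g dg x' y' xy (fun t _ => gdg t).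
    by apply: derivable_within_continuous => t _; apply: ex_derive.
  by exists c => //; rewrite in_itv /= in cxy.
have [xy|yx] := leP x y; first exact: H.
have [c cxy gxy] := H _ _ (ltW yx); exists c => //.
by rewrite -(opprB x y) mulrN -gxy opprB.
Qed.

Lemma mvt_coordinate f u i (x y : R) : (forall u, has_partial i f u) ->
  exists2 t, Num.min x y <= t <= Num.max x y &
    f (upd u i y) - f (upd u i x) = partial i f (upd u i t) * (y - x).
Proof.
move=> fi; apply: (@mvt (fun t => f (upd u i t)) (fun t => partial i f (upd u i t))).
by move=> t; apply: is_derive_upd.
Qed.

(** Passing from u to v one coordinate at a time. *)
Lemma mvt_sum f u v : (forall i u, has_partial i f u) ->
  exists2 xi : I -> I -> R, forall k, pinched u v (xi k) &
    f v - f u = \sum_(k <- e) partial k f (xi k) * (v k - u k).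
Proof.
move=> df; pose mix (p : seq I) i := if i \in p then v i else u i.
suff H p : uniq p -> exists2 xi : I -> I -> R, forall k, pinched u v (xi k) &
    f (mix p) - f u = \sum_(k <- p) partial k f (xi k) * (v k - u k).
  have -> : v = mix e by apply/funext => i; rewrite /mix e_all.
  have [xi xiP xiE] := H e e_uniq; exists xi; last first.
    by rewrite xiE; apply: eq_bigr => k _; rewrite /mix e_all.
  by move=> k i; have := xiP k i; rewrite /mix e_all.
elim: p => [_|k p IH /= /andP[kp up]].
  exists (fun=> u); first by move=> _ i; rewrite ge_min le_max lexx.
  by rewrite big_nil /mix /= subrr.
have [xi xiP xiE] := IH up.
have [t tP tE] := mvt_coordinate (mix p) (u k) (v k) (df k).
exists (fun j => if j == k then upd (mix p) k t else xi j).
  move=> j; case: ifP => _; last exact: xiP.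
  move=> i; rewrite /upd /= /mix; case: eqP => [->//|_].
  by case: ifP => _; rewrite ge_min le_max lexx ?orbT.
rewrite big_cons eqxx -tE.
have -> : upd (mix p) k (u k) = mix p.
  by rewrite -[RHS](upd_id _ k) /mix (negbTE kp).
have -> : upd (mix p) k (v k) = mix (k :: p).
  by apply/funext => i; rewrite /upd /mix /= in_cons; case: eqP => // ->.
rewrite -[LHS](subrKA (f (mix p))) xiE; congr (_ + _).
by apply: eq_big_seq => j jp; case: eqP => // jk; rewrite -jk jp in kp.
Qed.

Lemma ptws_cvg (T : Type) (G : set_system T) (X : T -> I -> R) u :
  Filter G -> (forall i, X n i @[n --> G] --> u i) ->
  X n @[n --> G] --> (u : {ptws I -> R}).
Proof.
move=> FG Xu; apply/cvg_sup => i.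
rewrite cvg_image; last by rewrite eqEsubset; split=> y // _; exists (cst y).
move=> W /(Xu i) XW; exists (@^~ i @^-1` W) => //.
by rewrite eqEsubset; split => [j [g /= Wg <-//]|j Wj]; exists (fun=> j).
Qed.

Lemma continuous_ptws (T : Type) (G : set_system T) (X : T -> I -> R) f u :
  Filter G -> continuous (f : {ptws I -> R} -> R) ->
  (forall i, X n i @[n --> G] --> u i) -> f (X n) @[n --> G] --> f u.
Proof.
move=> FG cf Xu.
exact: (@cvg_comp _ _ _ X (f : {ptws I -> R} -> R) _ _ _ (ptws_cvg FG Xu) (cf u)).
Qed.

(** Tychonoff: the points with coordinates in [a, b] form a compact set. *)
Lemma continuous_bounded f (a b : R) : continuous (f : {ptws I -> R} -> R) ->
  exists M, forall u, (forall i, a <= u i <= b) -> `|f u| <= M.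
Proof.
move=> cf; pose K : set {ptws I -> R} := [set u | forall i, `[a, b]%classic (u i)].
have cK : compact K.
  by apply: (@tychonoff I (fun=> R) (fun=> `[a, b]%classic)) => i; apply: segment_compact.
have : compact ((f : {ptws I -> R} -> R) @` K).
  by apply: continuous_compact => //; apply: continuous_subspaceT.
move=> /compact_bounded[M [_ HM]]; exists (M + 1).
move=> u uab; apply: HM; first by rewrite ltrDl.
by exists u => // i; rewrite /= in_itv /= uab.
Qed.

Lemma C1_lipschitz f (a b : R) : C1 f -> exists2 L, 0 <= L &
  forall u v (d : R), (forall i, a <= u i <= b) -> (forall i, a <= v i <= b) ->
    (forall i, `|u i - v i| <= d) -> `|f u - f v| <= L * d.
Proof.
case=> _ df cdf.
have [M HM] := choice (fun i => continuous_bounded a b (cdf i)).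
exists (\sum_(k <- e) `|M k|); first exact: sumr_ge0.
move=> u v d uab vab uvd; have [xi xiP ->] := mvt_sum v u df.
apply: le_trans (ler_norm_sum _ _ _) _; rewrite mulr_suml.
apply: ler_sum => k _; rewrite normrM; apply: ler_pM => //.
by apply: le_trans (ler_norm _); apply: HM; apply: pinched_in (xiP k).
Qed.

Lemma ltr_sum_one (F G : I -> R) k : (forall i, F i <= G i) -> F k < G k ->
  \sum_(i <- e) F i < \sum_(i <- e) G i.
Proof.
move=> FG FGk; rewrite !(bigD1_seq k) //=.
by apply: ltr_leD => //; apply: ler_sum => i _.
Qed.

Section submodularity.
Variable s : (I -> R) -> R.
Hypothesis s_C2 : C2 s.
Hypothesis s_off : forall k j, k != j -> forall u, partial k (partial j s) u <= 0.

(** By mvt_sum for partial j s, in which the coordinate j does not move. *)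
Lemma partial_antimonotone j u v : (forall i, u i <= v i) -> u j = v j ->
  partial j s v <= partial j s u.
Proof.
move=> uv uvj; have [_ ds _] := (s_C2.2 j).
have [xi xiP sE] := mvt_sum u v ds; rewrite -subr_le0 sE.
rewrite big_seq; apply: sumr_le0 => k _; have [->|kj] := eqVneq k j.
  by rewrite uvj subrr mulr0.
by rewrite mulr_le0_ge0 ?subr_ge0 // s_off.
Qed.

Lemma partial_strictly_antimonotone j k u v : (forall i, u i <= v i) ->
  u j = v j -> k != j -> (forall w, partial k (partial j s) w < 0) ->
  u k < v k -> partial j s v < partial j s u.
Proof.
move=> uv uvj kj sk uvk; have [_ ds _] := (s_C2.2 j).
have [xi xiP sE] := mvt_sum u v ds; rewrite -subr_lt0 sE.
rewrite (bigD1_seq k) //= ltr_wnDr //; last by rewrite pmulr_llt0 ?subr_gt0.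
apply: sumr_le0 => i _; have [->|ij] := eqVneq i j.
  by rewrite uvj subrr mulr0.
by rewrite mulr_le0_ge0 ?subr_ge0 // s_off.
Qed.

Lemma increment_antimonotone k w w' (y : R) : (forall i, w i <= w' i) ->
  w k = w' k -> w k <= y -> s (upd w' k y) - s w' <= s (upd w k y) - s w.
Proof.
move=> ww' wk wy; have [_ ds _] := s_C2.1.
have [t tP tE] := @mvt (fun t => s (upd w k t) - s (upd w' k t))
  (fun t => partial k s (upd w k t) - partial k s (upd w' k t)) (w k) y
  (fun t => is_deriveB (is_derive_upd w t (ds k)) (is_derive_upd w' t (ds k))).
move: tE; rewrite upd_id [in upd w' k (w k)]wk upd_id.
suff : 0 <= (partial k s (upd w k t) - partial k s (upd w' k t)) * (y - w k) by lra.
rewrite mulr_ge0 ?subr_ge0 //; apply: partial_antimonotone; last by rewrite !upd_same.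
by move=> i; rewrite /upd /=; case: eqP.
Qed.

(** The coordinates where u exceeds v are raised from min u v to u and,
    simultaneously, from v to max u v: each time the coordinate has the same
    value in both points, and the second point is the larger one. *)
Lemma submodular_of_partial u v :
  s (fun i => Num.min (u i) (v i)) + s (fun i => Num.max (u i) (v i)) <= s u + s v.
Proof.
pose lo (p : seq I) i := if i \in p then u i else Num.min (u i) (v i).
pose hi (p : seq I) i := if i \in p then Num.max (u i) (v i) else v i.
suff H p : s (hi p) - s v <= s (lo p) - s (fun i => Num.min (u i) (v i)).
  have := H e; have -> : lo e = u by apply/funext => i; rewrite /lo e_all.
  have -> : hi e = (fun i => Num.max (u i) (v i)).
    by apply/funext => i; rewrite /hi e_all.
  lra.
elim: p => [|k p IH]; first by rewrite /hi /lo /= !subrr.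
have hiE : hi (k :: p) = upd (hi p) k (Num.max (u k) (v k)).
  by apply/funext => i; rewrite /hi /upd /= in_cons; case: eqP => // ->.
have loE : lo (k :: p) = upd (lo p) k (u k).
  by apply/funext => i; rewrite /lo /upd /= in_cons; case: eqP => // ->.
have lohi i : lo p i <= hi p i.
  by rewrite /lo /hi; case: ifP => _; rewrite ?le_max ?ge_min lexx ?orbT.
suff : s (hi (k :: p)) - s (hi p) <= s (lo (k :: p)) - s (lo p) by lra.
rewrite hiE loE; have [uv|vu] := leP (u k) (v k).
  have -> : v k = hi p k by rewrite /hi (max_idPr uv); case: ifP.
  have -> : u k = lo p k by rewrite /lo (min_idPl uv); case: ifP.
  by rewrite !upd_id !subrr.
have [kp|kp] := boolP (k \in p).
  have {1}-> : u k = hi p k by rewrite /hi kp (max_idPl (ltW vu)).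
  have -> : u k = lo p k by rewrite /lo kp.
  by rewrite !upd_id !subrr.
apply: increment_antimonotone => //.
- by rewrite /lo /hi (negbTE kp) (min_idPr (ltW vu)).
- by rewrite /lo (negbTE kp) ge_min lexx.
Qed.

End submodularity.
End finitely_many_variables.

(** * Configurations that depend on the first coordinate only *)

Section lattice.
Variables (R : realType) (n : nat).
Implicit Types (u : config R n) (i j : 'rV[int]_n).

Lemma l1norm_ge i k : (absz (i ord0 k) <= l1norm i)%N.
Proof. by rewrite /l1norm (bigD1 k) //= leq_addr. Qed.

Lemma l1normN i : l1norm (- i) = l1norm i.
Proof. by apply: eq_bigr => k _; rewrite mxE abszN. Qed.

Lemma in_box r i : (l1norm i <= r)%N -> {k : box n r | val k = i}.
Proof. by move=> ir; exists (exist (fun k => is_true (l1norm k <= r)%N) i ir). Qed.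

(** A ball of the lattice is listed through the cube that contains it. *)
Lemma box_enum r : exists2 e : seq (box n r), uniq e & forall k, k \in e.
Proof.
pose vec (f : {ffun 'I_n -> 'I_(2 * r).+1}) : 'rV[int]_n :=
  \row_k ((f k)%:Z - r%:Z).
pose l := [seq vec f | f <- enum [set: {ffun 'I_n -> 'I_(2 * r).+1}]].
exists (undup (pmap insub l)); first exact: undup_uniq.
move=> k; rewrite mem_undup mem_pmap_sub; apply/mapP.
exists [ffun c => inord (absz (val k ord0 c + r%:Z))].
  by rewrite mem_enum inE.
apply/rowP => c; rewrite mxE ffunE.
have inordE (z : int) : (absz z <= r)%N ->
    z = (@inord (2 * r) (absz (z + r%:Z)))%:Z - r%:Z.
  by move=> zr; rewrite inordK; lia.
exact: (inordE _ (leq_trans (l1norm_ge (val k) c) (valP k))).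
Qed.

Lemma shift_byE j u : shift_by j u = fun i => u (i + j).
Proof.
suff H (l : seq 'I_n) (v : config R n) : foldl (fun v k => tau k (j ord0 k) v) v l =
    fun i => v (i + \sum_(k <- l) j ord0 k *: delta_mx ord0 k).
  by rewrite /shift_by H big_enum /= -row_sum_delta.
elim: l v => [|k l IH] v /=.
  by apply/funext => i; rewrite big_nil addr0.
rewrite IH; apply/funext => i; rewrite /tau big_cons.
by congr (v _); rewrite -addrA [X in _ + X]addrC.
Qed.

Definition invariant_under j u : Prop := forall i, u (i + j) = u i.

Lemma invariant_under_scale j u (m : int) :
  invariant_under j u -> invariant_under (m *: j) u.
Proof.
move=> uj; elim/int_rect: m => [i|m IH i|m IH i].
- by rewrite scale0r addr0.
- by rewrite -[m.+1]addn1 PoszD scalerDl scale1r addrA uj.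
- rewrite -[RHS]IH -[LHS]uj -addrA -[X in _ + (_ + X)]scale1r -scalerDl.
  by congr (u (_ + _ *: _)); lia.
Qed.

Lemma invariant_under_sum (P : pred 'I_n) (m : 'I_n -> int) u :
  (forall k, P k -> invariant_under (delta_mx ord0 k) u) ->
  invariant_under (\sum_(k | P k) m k *: delta_mx ord0 k) u.
Proof.
move=> uP; apply: (big_ind (invariant_under^~ u)) => [i|j j' uj uj' i|k Pk].
- by rewrite addr0.
- by rewrite addrA uj' uj.
- exact/invariant_under_scale/uP.
Qed.

Lemma Gamma0P u : Gamma0 u -> u = fun=> u 0.
Proof.
move=> uG; apply/funext => i; rewrite -[in LHS](add0r i) [in LHS](row_sum_delta i).
by apply: invariant_under_sum => k _ j; apply: uG.
Qed.

End lattice.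

Section planar.
Variables (R : realType) (n : nat).
Implicit Types (u : config R n.+1) (x : int -> R).

Definition planar x : config R n.+1 := fun i => x (i ord0 ord0).

Lemma Tpoint00 t : @Tpoint n t ord0 ord0 = t.
Proof. by rewrite /Tpoint !mxE mulr1. Qed.

Lemma planar_Tpoint x t : planar x (Tpoint n t) = x t.
Proof. by rewrite /planar Tpoint00. Qed.

Lemma planarP u : (forall k : 'I_n.+1, k != ord0 ->
    forall i, u (i + delta_mx ord0 k) = u i) ->
  u = planar (fun t => u (Tpoint n t)).
Proof.
move=> uk; apply/funext => i.
rewrite [in LHS](row_sum_delta i) (bigD1 ord0) //=.
exact: invariant_under_sum.
Qed.

Lemma planar_periodic x (k : 'I_n.+1) i : k != ord0 ->
  planar x (i + delta_mx ord0 k) = planar x i.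
Proof. by move=> k0; rewrite /planar !mxE eqxx /= eq_sym (negbTE k0) addr0. Qed.

End planar.

Section planar_energy.
Variables (R : realType) (n r : nat) (s : (box n.+1 r -> R) -> R).
Implicit Types (x y : int -> R).

Definition first_coord (k : box n.+1 r) : int := val k ord0 ord0.

(** The local potential of a planar configuration, as a function of its profile
    and normalized to vanish at the constants of least energy. *)
Definition profile_pot x : R := s (fun k => x (first_coord k)) - c0 s.

Lemma first_coord_bound k : - r%:Z <= first_coord k <= r%:Z.
Proof.
have := leq_trans (l1norm_ge (val k) ord0) (valP k); rewrite -/(first_coord k).
lia.
Qed.

Lemma J1i_planar t x : J1i s t (planar x) = profile_pot (shift t x).
Proof.
rewrite /J1i /local_pot shift_byE /profile_pot; congr (s _ - _).
by apply/funext => k; rewrite /planar mxE Tpoint00.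
Qed.

Lemma J1pq_planar (m q : nat) x :
  J1pq s (- m%:Z) q%:Z (planar x) = seg profile_pot x (- m%:Z) (m + q).+1.
Proof.
rewrite /J1pq /seg.
have -> : [set i : int | - m%:Z <= i <= q%:Z] =
    [set` [seq - m%:Z + l%:Z | l <- iota 0 (m + q).+1]].
  apply/seteqP; split => [i mq|i /mapP[l]].
    apply/mapP; rewrite /mkset in mq.
    by exists (absz (i + m%:Z)); rewrite ?mem_iota; lia.
  by rewrite mem_iota /mkset => ? ->; lia.
rewrite -fsbig_seq; last first.
  by rewrite map_inj_uniq ?iota_uniq // => i j; lia.
rewrite big_map -(big_mkord xpredT (fun l => profile_pot (shift (- m%:Z + l%:Z) x))).
rewrite /index_iota subn0; apply: eq_bigr => l _; exact: J1i_planar.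
Qed.

Lemma J0_cst c : J0 s (fun=> c) = s (fun=> c).
Proof. by rewrite /J0 /local_pot shift_byE. Qed.

End planar_energy.

(** * The Euler-Lagrange equation of planar minimizers *)

Section planar_minimizers.
Variables (R : realType) (n r : nat) (s : (box n.+1 r -> R) -> R).
Hypothesis s_adm : admissible s.
Implicit Types (x y : int -> R).
Local Notation h := (profile_pot s).
Local Notation c1 := (@first_coord n r).

Lemma c0_le c : c0 s <= s (fun=> c).
Proof.
have [_ _ [[m ms] _] _] := s_adm.
apply: ge_inf; first by exists m => _ [u _ <-]; apply: ms.
by exists (fun=> c); rewrite ?J0_cst // => k i.
Qed.

Lemma profile_pot_cst c : h (fun=> c) = s (fun=> c) - c0 s.
Proof. by []. Qed.

Variables (e : seq (box n.+1 r)) (a b : R).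
Hypotheses (e_uniq : uniq e) (e_all : forall k, k \in e).

Lemma profile_pot_lipschitz : exists2 L, 0 <= L & window_lipschitz a b r L h.
Proof.
have [[s_C1 _] _ _ _] := s_adm.
have [L L0 HL] := C1_lipschitz e_uniq e_all a b s_C1.
exists L => // x y d Kx Ky xy; rewrite /profile_pot opprB addrA subrK.
by apply: HL => k //; apply: xy; apply: first_coord_bound.
Qed.

Lemma profile_pot_submodular : submodular h.
Proof.
have [s_C2 _ _ [s_off _]] := s_adm; move=> x y.
have := submodular_of_partial e_uniq e_all s_C2 s_off
  (fun k => x (c1 k)) (fun k => y (c1 k)).
rewrite /profile_pot /fmin /fmax; lra.
Qed.

Definition window_at x (i : int) : box n.+1 r -> R := fun k => x (c1 k + i).

(** The left-hand side of the Euler-Lagrange equation of planar x at a site with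
    first coordinate i. *)
Definition planar_EL x (i : int) : R :=
  \sum_(k <- e) partial k s (window_at x (i - c1 k)).

Lemma planar_EL_solution x : (forall i, planar_EL x i = 0) ->
  EL_solution s (planar x : config R n.+1).
Proof.
move=> xEL i; rewrite -[RHS](xEL (i ord0 ord0)).
have -> : [set j : 'rV[int]_n.+1 | (l1norm (j - i) <= r)%N] =
    [set` [seq i - val k | k <- e]].
  apply/seteqP; split => [j ji|j /mapP[k _ ->]]; last first.
    by rewrite /mkset addrAC subrr add0r l1normN; apply: valP k.
  have ij : (l1norm (i - j) <= r)%N by rewrite -l1normN opprB.
  have [k kE] := in_box ij.
  by apply/mapP; exists k; rewrite ?e_all //= kE opprB addrC subrK.
rewrite -fsbig_seq; last first.
  rewrite map_inj_uniq // => k k' /= kk'; apply: val_inj.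
  by apply: oppr_inj; apply: (addrI i).
rewrite big_map; apply: eq_bigr => k _.
rewrite /partial /window_at.
have -> : x (c1 k + (i ord0 ord0 - c1 k)) = planar x i.
  by rewrite /planar; congr x; lia.
congr (derive1 _ _); apply/funext => t; rewrite /local_pot shift_byE.
congr s; apply/funext => k' /=.
have -> : (val k' + (i - val k) == i) = (k' == k).
  by rewrite addrCA -subr_eq0 addrAC subrr add0r subr_eq0 (inj_eq val_inj).
by case: ifP => // _; rewrite /planar !mxE.
Qed.

Hypothesis r_ge1 : (1 <= r)%N.

(** The neighbour i + d is the centre of the window in which i is the point k with
    first coordinate - d, and the mixed derivative of s at 0 and k is negative. *)
Lemma planar_EL_strict x y i (d : int) : (forall t, x t <= y t) ->
  x i = y i -> absz d = 1%N -> x (i + d) < y (i + d) ->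
  planar_EL y i < planar_EL x i.
Proof.
have [s_C2 _ _ [s_off s_strict]] := s_adm.
move=> xy xyi d1 xyd.
have norm0 : l1norm (0 : 'rV[int]_n.+1) = 0%N.
  by rewrite /l1norm big1 // => k _; rewrite mxE.
have norm1 : l1norm (@Tpoint n (- d)) = 1%N.
  rewrite /l1norm (bigD1 ord0) //= Tpoint00 abszN d1 big1 // => k k0.
  by rewrite /Tpoint !mxE eqxx (negbTE k0) mulr0.
have [|z zE] := @in_box n.+1 r 0; first by rewrite norm0.
have [|k kE] := @in_box n.+1 r (Tpoint n (- d)); first by rewrite norm1.
apply: (ltr_sum_one e_uniq e_all (k := k)) => [j|].
  apply: (partial_antimonotone e_uniq e_all s_C2 s_off); first by move=> ?; apply: xy.
  by rewrite /window_at addrC subrK.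
have c1k : c1 k = - d by rewrite /first_coord kE Tpoint00.
have c1z : c1 z = 0 by rewrite /first_coord zE mxE.
apply: (partial_strictly_antimonotone e_uniq e_all s_C2 s_off (k := z)).
- by move=> ?; apply: xy.
- by rewrite /window_at addrC subrK.
- by apply/eqP => zk; have := congr1 c1 zk; rewrite c1z c1k; lia.
- by move=> w; apply: s_strict; rewrite ?kE.
- by rewrite /window_at c1z c1k add0r opprK.
Qed.

(** Where x and y touch, the two neighbours have to touch as well. *)
Lemma strong_maximum_principle x y i : (forall t, x t <= y t) ->
  (forall t, x t = y t -> planar_EL x t <= planar_EL y t) -> x i = y i ->
  forall t, x t = y t.
Proof.
move=> xy ELxy xyi.
have step t (d : int) : absz d = 1%N -> x t = y t -> x (t + d) = y (t + d).
  move=> d1 xyt; apply/eqP; rewrite eq_le xy /= leNgt; apply/negP => lt.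
  by have := planar_EL_strict xy xyt d1 lt; rewrite ltNge ELxy.
move=> t; rewrite -(subrK i t); elim/int_rect: (t - i) => [|m IH|m IH].
- by rewrite add0r.
- by rewrite (_ : m.+1%:Z + i = m%:Z + i + 1); [apply: step|lia].
- by rewrite (_ : - m.+1%:Z + i = - m%:Z + i + - 1); [apply: step|lia].
Qed.

(** The intermediate points of mvt_sum converge with the ends of the path, and the
    first derivatives of s are continuous. *)
Lemma pinched_sum_cvg (u : box n.+1 r -> box n.+1 r -> R)
    (U xi : nat -> box n.+1 r -> box n.+1 r -> R) :
  (forall k i, U N k i @[N --> \oo] --> u k i) ->
  (forall N k, pinched (u k) (U N k) (xi N k)) ->
  \sum_(k <- e) partial k s (xi N k) @[N --> \oo] -->
    \sum_(k <- e) partial k s (u k).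
Proof.
have [[[_ _ s'_cont] _] _ _ _] := s_adm.
move=> Uu pin; apply: cvg_sum_seq => k; apply: continuous_ptws => [|i].
  exact: s'_cont.
apply/cvgrPdist_le => d d0; have /cvgrPdist_le/(_ d d0)[N _ HN] := Uu k i.
exists N => // m /= /HN; apply: le_trans.
by rewrite distrC [leRHS]distrC; apply: pinched_dist.
Qed.

Lemma limit_sign (E : nat -> R) (E0 d : R) : E N @[N --> \oo] --> E0 ->
  (forall N, 0 <= E N * (d * N.+1%:R^-1)) -> 0 <= E0 * d.
Proof.
move=> EE pos; have cv : E N * d @[N --> \oo] --> E0 * d.
  by apply: cvgM => //; apply: cvg_cst.
apply: (cvgr_to_ge cv); apply: nearW => N; have := pos N.
by rewrite mulrA pmulr_lge0 // invr_gt0.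
Qed.

Lemma cvg_scaled (c d : R) : c + d * N.+1%:R^-1 @[N --> \oo] --> c.
Proof.
rewrite -[X in _ --> X]addr0 -[X in _ + X](mulr0 d).
by apply: cvgD; [apply: cvg_cst|apply: cvgM; [apply: cvg_cst|apply: cvg_harmonic]].
Qed.

(** The constant c minimizes s among the constants, and the derivative of
    t |-> s (fun=> t) at c is planar_EL. *)
Lemma planar_EL_cst c i : s (fun=> c) = c0 s -> planar_EL (fun=> c) i = 0.
Proof.
have [[[_ ds _] _] _ _ _] := s_adm; move=> sc.
suff sign d : 0 <= planar_EL (fun=> c) i * d.
  by have := sign 1; have := sign (- 1); rewrite mulr1 mulrN1; lra.
have H (N : nat) : exists xi : box n.+1 r -> box n.+1 r -> R,
    (forall k, pinched (fun=> c) (fun=> c + d * N.+1%:R^-1) (xi k)) /\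
    0 <= (\sum_(k <- e) partial k s (xi k)) * (d * N.+1%:R^-1).
  have [xi pin sE] := mvt_sum e_uniq e_all (fun=> c) (fun=> c + d * N.+1%:R^-1) ds.
  exists xi; split => //; rewrite mulr_suml.
  under eq_bigr do rewrite -[X in _ * X](addrK c) [X in _ * (X - _)]addrC.
  by rewrite -sE sc subr_ge0 c0_le.
have [xi Hxi] := choice H.
apply: (@limit_sign (fun N => \sum_(k <- e) partial k s (xi N k))); last first.
  by move=> N; have [] := Hxi N.
apply: (@pinched_sum_cvg (fun _ _ => c) (fun N _ _ => c + d * N.+1%:R^-1)).
  by move=> _ _; apply: cvg_scaled.
by move=> N; have [] := Hxi N.
Qed.

(** Only the windows that contain i change, and site i is the point k of the
    window around i - first_coord k. *)
Lemma first_variation x y i : (forall j, j != i -> y j = x j) ->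
  exists xi : box n.+1 r -> box n.+1 r -> R,
    (forall k, pinched (window_at x (i - c1 k)) (window_at y (i - c1 k)) (xi k)) /\
    seg h y (i - r%:Z) (2 * r).+1 - seg h x (i - r%:Z) (2 * r).+1 =
    (\sum_(k <- e) partial k s (xi k)) * (y i - x i).
Proof.
have [[[_ ds _] _] _ _ _] := s_adm; move=> yx.
have H (l : nat) : exists xi : box n.+1 r -> box n.+1 r -> R,
    (forall k, pinched (window_at x (i - r%:Z + l%:Z))
      (window_at y (i - r%:Z + l%:Z)) (xi k)) /\
    h (shift (i - r%:Z + l%:Z) y) - h (shift (i - r%:Z + l%:Z) x) =
    \sum_(k <- e) partial k s (xi k) *
      (y (c1 k + (i - r%:Z + l%:Z)) - x (c1 k + (i - r%:Z + l%:Z))).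
  have [xi pin sE] := mvt_sum e_uniq e_all (window_at x (i - r%:Z + l%:Z))
    (window_at y (i - r%:Z + l%:Z)) ds.
  by exists xi; split => //; rewrite -sE /profile_pot opprB addrA subrK.
have [xi Hxi] := choice H.
have lk k : i - r%:Z + (absz (r%:Z - c1 k))%:Z = i - c1 k.
  by have := first_coord_bound k; lia.
exists (fun k => xi (absz (r%:Z - c1 k)) k); split.
  by move=> k; have [+ _] := Hxi (absz (r%:Z - c1 k)); rewrite lk; apply.
rewrite /seg -sumrB; under eq_bigr do rewrite (Hxi _).2.
rewrite exchange_big mulr_suml /=; apply: eq_bigr => k _.
have lt : (absz (r%:Z - c1 k) < (2 * r).+1)%N by have := first_coord_bound k; lia.
have ci : c1 k + (i - c1 k) = i by rewrite addrC subrK.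
rewrite (bigD1 (Ordinal lt)) //= lk ci big1 ?addr0 //.
move=> l /eqP lk'; rewrite yx ?subrr ?mulr0 //.
by apply/eqP => E; apply: lk'; apply: val_inj => /=; move: E; lia.
Qed.

(** Moving x i by d / (N + 1) keeps the values in [a, b] and cannot lower the
    energy; the increment divided by 1 / (N + 1) converges to planar_EL x i * d. *)
Lemma minimal_EL_sign x c i d : minimal a b h x c ->
  a <= x i + d <= b -> 0 <= planar_EL x i * d.
Proof.
move=> xmin xd; have [[Kx _ _] _ _] := xmin.
pose y (N : nat) (j : int) := if j == i then x i + d * N.+1%:R^-1 else x j.
have yx N j : j != i -> y N j = x j by rewrite /y => /negbTE ->.
have Ky N : between a b (y N).
  move=> j; rewrite /y; case: ifP => // _.
  have := Kx i; have : 0 <= (N.+1%:R^-1 : R) <= 1.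
    by rewrite invr_ge0 ler0n invf_le1 // ler1n.
  by move: (N.+1%:R^-1) => q; have := xd; nra.
have le_ab : a <= b by have := Kx i; lra.
have [L L0 hL] := profile_pot_lipschitz.
have [xi Hxi] := choice (fun N => first_variation (yx N)).
have yi N : y N i - x i = d * N.+1%:R^-1 by rewrite /y eqxx addrC addKr.
apply: (@limit_sign (fun N => \sum_(k <- e) partial k s (xi N k))); last first.
  move=> N; rewrite -yi; have [_ <-] := Hxi N.
  exact: (minimal_local le_ab L0 hL xmin (Ky N) (yx N)).
apply: (@pinched_sum_cvg _ (fun N k => window_at (y N) (i - c1 k))).
  move=> k j; rewrite /window_at /y; case: eqP => [->|_]; last exact: cvg_cst.
  exact: cvg_scaled.
by move=> N; have [] := Hxi N.
Qed.

Hypothesis lt_ab : a < b.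
Hypothesis s_a : s (fun=> a) = c0 s.
Hypothesis s_b : s (fun=> b) = c0 s.

(** Where x touches a its first variation is nonnegative, while the constant a is
    a solution below x; the strong maximum principle would make x constant. *)
Lemma minimal_interior x c i : minimal a b h x c -> a < x i < b.
Proof.
move=> xmin; have [[Kx xa xb] _ _] := xmin.
have /andP[axi xib] := Kx i.
rewrite !lt_neqAle axi xib !andbT; apply/andP; split; apply/eqP => xi.
- have x_cst : forall t, a = x t.
    apply: (@strong_maximum_principle (fun=> a) x i) => [t|t at_|].
    + by case/andP: (Kx t).
    + rewrite planar_EL_cst //.
      have := @minimal_EL_sign x c t (b - a) xmin.
      rewrite -at_ addrC subrK (ltW lt_ab) lexx => /(_ isT).
      by rewrite pmulr_lge0 // subr_gt0.
    + by [].
  have xa' : x m%:Z @[m --> \oo] --> a.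
    by under eq_fun do rewrite -x_cst; apply: cvg_cst.
  by move: lt_ab; rewrite (cvg_unique _ xa' xb) ?ltxx.
- have x_cst : forall t, x t = b.
    apply: (@strong_maximum_principle x (fun=> b) i) => [t|t bt|].
    + by case/andP: (Kx t).
    + rewrite planar_EL_cst //.
      have := @minimal_EL_sign x c t (a - b) xmin.
      rewrite bt addrC subrK (ltW lt_ab) lexx => /(_ isT).
      by rewrite nmulr_lge0 // subr_lt0.
    + by [].
  have xb' : x (- m%:Z) @[m --> \oo] --> b.
    by under eq_fun do rewrite x_cst; apply: cvg_cst.
  by move: lt_ab; rewrite (cvg_unique _ xa xb') ?ltxx.
Qed.

Lemma minimal_EL x c i : minimal a b h x c -> planar_EL x i = 0.
Proof.
move=> xmin; have /andP[ax xb] := minimal_interior i xmin.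
apply/eqP; rewrite eq_le; apply/andP; split.
- have := @minimal_EL_sign x c i (a - x i) xmin.
  rewrite addrC subrK lexx (ltW lt_ab) => /(_ isT).
  by rewrite nmulr_lge0 // subr_lt0.
- have := @minimal_EL_sign x c i (b - x i) xmin.
  rewrite addrC subrK lexx (ltW lt_ab) => /(_ isT).
  by rewrite pmulr_lge0 // subr_gt0.
Qed.

Lemma profile_pot_cst_ge0 c : a <= c <= b -> 0 <= h (fun=> c).
Proof. by rewrite profile_pot_cst subr_ge0 c0_le. Qed.

Lemma profile_pot_a : h (fun=> a) = 0. Proof. by rewrite profile_pot_cst s_a subrr. Qed.
Lemma profile_pot_b : h (fun=> b) = 0. Proof. by rewrite profile_pot_cst s_b subrr. Qed.

(** The maximum of x and y is a solution that touches x or y at 0, hence equals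
    it; so x and y are comparable, and distinct comparable solutions do not
    touch. *)
Lemma minimal_ordered x y c : minimal a b h x c -> minimal a b h y c ->
  [\/ forall t, x t < y t, x = y | forall t, y t < x t].
Proof.
move=> xmin ymin; have [L L0 hL] := profile_pot_lipschitz.
have M := minimal_fmax (ltW lt_ab) L0 hL profile_pot_submodular
  profile_pot_cst_ge0 profile_pot_a.
have compare z z' : minimal a b h z c -> minimal a b h z' c ->
    (forall t, z t <= z' t) -> z = z' \/ forall t, z t < z' t.
  move=> zmin zmin' zz'; have [[t zt]|no] := pselect (exists t, z t = z' t).
    left; apply/funext; apply: (strong_maximum_principle zz' _ zt) => t' _.
    by rewrite (minimal_EL t' zmin) (minimal_EL t' zmin').
  right => t; rewrite lt_neqAle zz' andbT; apply/eqP => zt.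
  by apply: no; exists t.
have side z z' : minimal a b h z c -> minimal a b h z' c ->
    fmax z z' 0 = z 0 -> z' = z \/ forall t, z' t < z t.
  move=> zmin zmin' z0; apply: (compare _ _ zmin' zmin) => t.
  have -> : z = fmax z z'.
    have [t'|//|lt] := compare _ _ zmin (M _ _ _ zmin zmin').
      by rewrite /fmax le_max lexx.
    by have := lt 0; rewrite z0 ltxx.
  by rewrite /fmax le_max lexx orbT.
have [x0|y0] := fmax_either x y 0.
  by have [->|] := side _ _ xmin ymin x0; [constructor 2|constructor 3].
have y0' : fmax y x 0 = y 0 by rewrite -y0 /fmax maxC.
by have [->|] := side _ _ ymin xmin y0'; [constructor 2|constructor 1].
Qed.

Lemma minimal_increasing x c : minimal a b h x c -> forall t, x t < x (t + 1).
Proof.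
move=> xmin; have [L L0 hL] := profile_pot_lipschitz.
have smin := minimal_shift (ltW lt_ab) L0 hL profile_pot_submodular
  profile_pot_cst_ge0 profile_pot_a 1 xmin.
have [[Kx xa xb] _ _] := xmin.
have absurd_ : ~ (forall t, x (t + 1) <= x t).
  move=> dec; have le m : x (m%:Z) <= x (- m%:Z).
    have D t (k : nat) : x (t + k%:Z) <= x t.
      elim: k => [|k IH]; first by rewrite addr0.
      by apply: le_trans IH; rewrite (_ : t + k.+1%:Z = t + k%:Z + 1) //; lia.
    by have := D (- m%:Z) (m + m)%N; rewrite (_ : - m%:Z + (m + m)%N%:Z = m%:Z) //; lia.
  have : b <= a by apply: (ler_cvg_to xb xa); apply: nearW => m; apply: le.
  by rewrite leNgt lt_ab.
have [//|E|lt] := minimal_ordered xmin smin; case: absurd_ => t.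
  by rewrite {2}E.
exact/ltW/lt.
Qed.
End planar_minimizers.

(** * From profiles to configurations *)

Section bridge.
Variables (R : realType) (n r : nat) (s : (box n.+1 r -> R) -> R) (a b L : R).
Implicit Types (u : config R n.+1) (x : int -> R).
Local Notation h := (profile_pot s).
Local Notation v0 := ((fun=> a) : config R n.+1).
Local Notation w0 := ((fun=> b) : config R n.+1).

Lemma cvg_dist0 (w : nat -> R) (c : R) :
  `|w m - c| @[m --> \oo] --> (0 : R) <-> w m @[m --> \oo] --> c.
Proof.
split => /cvgrPdist_le H; apply/cvgrPdist_le => e /H [N _ HN].
  by exists N => // m /HN /=; rewrite sub0r normrN normr_id distrC.
by exists N => // m /HN /=; rewrite sub0r normrN normr_id distrC.
Qed.

Lemma Gamma1_planar x : Gamma1 v0 w0 (planar x) <-> hetero a b x.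
Proof.
split=> [[[vx xw _] xa xb]|[Kx xa xb]].
  split.
  - by move=> t; have := vx (Tpoint n t); have := xw (Tpoint n t);
      rewrite planar_Tpoint => -> ->.
  - by move: xa; under eq_fun do rewrite planar_Tpoint; move/cvg_dist0.
  - by move: xb; under eq_fun do rewrite planar_Tpoint; move/cvg_dist0.
split.
- split => [i|i|k k0 i]; first by case/andP: (Kx (i ord0 ord0)).
    by case/andP: (Kx (i ord0 ord0)).
  exact: planar_periodic.
- by under eq_fun do rewrite planar_Tpoint; apply/cvg_dist0.
- by under eq_fun do rewrite planar_Tpoint; apply/cvg_dist0.
Qed.

Lemma Gamma1P u : Gamma1 v0 w0 u ->
  exists2 x, u = planar x & hetero a b x.
Proof.
move=> Gu; have [[_ _ uk] _ _] := Gu; have uE := planarP uk.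
exists (fun t => u (Tpoint n t)) => //.
by apply/Gamma1_planar; rewrite -uE.
Qed.

Hypothesis le_ab : a <= b.
Hypothesis L_ge0 : 0 <= L.
Hypothesis h_lip : window_lipschitz a b r L h.
Hypothesis h_sub : submodular h.
Hypothesis h_cst_ge0 : forall c, a <= c <= b -> 0 <= h (fun=> c).
Hypothesis h_a : h (fun=> a) = 0.

Lemma J1_energy x c : hetero a b x -> has_energy h x c ->
  J1 s (planar x) = c%:E.
Proof.
move=> Gx Ec; rewrite /J1 limf_einfE.
pose f := fun mq : nat * nat => (J1pq s (- mq.1%:Z) mq.2%:Z (planar x))%:E.
have near (d : R) : 0 < d -> exists M : nat, forall mq : nat * nat,
    (M <= mq.1)%N -> (M <= mq.2)%N -> ((c - d)%:E <= f mq <= (c + d)%:E)%E.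
  move=> d0; have [M HM] := seg_cvg le_ab L_ge0 h_lip h_sub h_cst_ge0 h_a Gx Ec d0.
  exists M => -[m q] /= Mm Mq; rewrite /f /= J1pq_planar !lee_fin.
  by have := HM m q Mm Mq; rewrite ler_norml => /andP[] ? ?; apply/andP; split; lra.
apply/eqP; rewrite eq_le; apply/andP; split.
- apply: ge_ereal_sup => _ [V [[A B] [[NA _ HA] [NB _ HB]] AB] <-].
  apply/lee_addgt0Pr => d d0; have [M HM] := near d d0.
  pose mq : nat * nat := ((NA + M)%N, (NB + M)%N).
  apply: (@le_trans _ _ (f mq)).
    apply: ereal_inf_lbound; exists mq => //; apply: AB.
    by split; [apply: HA|apply: HB] => /=; rewrite leq_addr.
  by have /andP[] := HM mq (leq_addl _ _) (leq_addl _ _).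
- apply/lee_subgt0Pr => d d0; have [M HM] := near d d0.
  apply: (@le_trans _ _ (ereal_inf (f @` ([set m | (M <= m)%N] `*` [set q | (M <= q)%N])))).
    by apply: le_ereal_inf_tmp => _ [mq [/= Mm Mq] <-]; have /andP[] := HM mq Mm Mq.
  apply: ereal_sup_ubound; exists ([set m | (M <= m)%N] `*` [set q | (M <= q)%N]) => //.
  by exists ([set m | (M <= m)%N], [set q | (M <= q)%N]) => //; split; exists M.
Qed.

(** If the lower limit is finite, intervals growing to the whole line carry
    bounded energy, which bounds all corrected partial sums. *)
Lemma J1_finite x : hetero a b x -> (J1 s (planar x) < +oo)%E ->
  exists c, has_energy h x c.
Proof.
move=> Gx; rewrite /J1 limf_einfE => J1oo.
have [C] : exists C : R, (ereal_sup [set ereal_inf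
    ((fun mq : nat * nat => (J1pq s (- mq.1%:Z) mq.2%:Z (planar x))%:E) @` V) |
    V in filter_prod \oo \oo] < C%:E)%E.
  case: (ereal_sup _) J1oo => [C|//|_]; last by exists 0; rewrite ltNyr.
  by exists (C + 1); rewrite lte_fin ltrDl.
move=> {}J1oo.
apply: (energy_exists_frequently le_ab L_ge0 h_lip h_sub h_cst_ge0 h_a (C := C) Gx).
move=> N; apply: contrapT => no; move: J1oo; apply/negP; rewrite -leNgt.
pose V := [set m | (N <= m)%N] `*` [set q | (N <= q)%N].
apply: (@le_trans _ _ (ereal_inf
    ((fun mq : nat * nat => (J1pq s (- mq.1%:Z) mq.2%:Z (planar x))%:E) @` V))).
  apply: le_ereal_inf_tmp => _ [[m q] [/= Nm Nq] <-]; rewrite J1pq_planar lee_fin leNgt.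
  by apply/negP => /ltW lt; apply: no; exists m, q.
apply: ereal_sup_ubound; exists V => //.
by exists ([set m | (N <= m)%N], [set q | (N <= q)%N]) => //; split; exists N.
Qed.

Lemma c1E x c : minimal a b h x c -> c1 s v0 w0 = c%:E.
Proof.
case=> Gx Ec minc; apply/eqP; rewrite eq_le; apply/andP; split.
  apply: ereal_inf_lbound; exists (planar x); first exact/Gamma1_planar.
  exact: J1_energy.
apply: le_ereal_inf_tmp => _ [u Gu <-]; have [y -> Gy] := Gamma1P Gu.
have [oo|oo] := ltP (J1 s (planar y)) +oo%E; last by apply: le_trans oo; rewrite leey.
have [c' Ec'] := J1_finite Gy oo.
by rewrite (J1_energy Gy Ec') lee_fin; apply: minc Ec'.
Qed.

Lemma M1_planar x c y : minimal a b h x c ->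
  M1 s v0 w0 (planar y) <-> minimal a b h y c.
Proof.
move=> xmin; have [_ _ minc] := xmin; split=> [[/Gamma1_planar Gy J1y]|[Gy Ey _]].
  move: J1y; rewrite (c1E xmin) => J1y.
  have [c' Ec'] : exists c', has_energy h y c'.
    by apply: J1_finite => //; rewrite J1y ltry.
  have := J1_energy Gy Ec'; rewrite J1y => -[cc'].
  by split => //; rewrite cc'.
split; first exact/Gamma1_planar.
by rewrite (c1E xmin) (J1_energy Gy Ey).
Qed.

Lemma M1P u : M1 s v0 w0 u -> exists x, u = planar x.
Proof. by case=> /Gamma1P[x -> _] _; exists x. Qed.

End bridge.

Theorem theorem3p13 (R : realType) (n r : nat) (r_ge1 : (1 <= r)%N)
    (s : (box n.+1 r -> R) -> R) (s_adm : admissible s)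
    (v0 w0 : config R n.+1) (v0w0 : adjacent_in (M0 s) v0 w0) :
  [/\ exists U1, M1 s v0 w0 U1 /\ EL_solution s U1,
      is_ordered (M1 s v0 w0),
      forall U, M1 s v0 w0 U -> EL_solution s U &
      forall U, M1 s v0 w0 U -> cfg_lt U (tau ord0 1 U)].
Proof.
have [[/Gamma0P v0E Jv0] [/Gamma0P w0E Jw0] lt_vw no_between] := v0w0.
move: {v0w0} (v0 0) (w0 0) v0E w0E Jv0 Jw0 lt_vw no_between => a b -> ->.
rewrite !J0_cst => s_a s_b lt_vw no_between.
have lt_ab : a < b by apply: (lt_vw 0).
have s_zero c : a <= c <= b -> profile_pot s (fun=> c) = 0 -> c = a \/ c = b.
  move=> /andP[ac cb]; rewrite profile_pot_cst => /subr0_eq sc.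
  apply: contrapT => cab; apply: no_between; exists (fun=> c); split.
  - by split; [move=> k i|rewrite J0_cst].
  - by move=> i.
  - by move=> i.
  - by move=> E; apply: cab; left; rewrite -[RHS]/((fun=> a) (0 : 'rV[int]_n.+1)) -E.
  - by move=> E; apply: cab; right; rewrite -[RHS]/((fun=> b) (0 : 'rV[int]_n.+1)) -E.
have [e e_uniq e_all] := box_enum n.+1 r.
have [L L0 hL] := profile_pot_lipschitz s_adm a b e_uniq e_all.
have hsub := profile_pot_submodular s_adm e_uniq e_all.
have hge0 := profile_pot_cst_ge0 s_adm (a := a) (b := b).
have ha := profile_pot_a s_a; have hb := profile_pot_b s_b.
have [x [c xmin]] := minimizer_exists (ltW lt_ab) L0 hL hsub hge0 ha hb s_zero lt_ab.
have M1E y := M1_planar (ltW lt_ab) L0 hL hsub hge0 ha y xmin.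
have EL U : M1 s (fun=> a) (fun=> b) U -> EL_solution s U.
  move=> MU; have [y yE] := M1P MU; move: MU; rewrite yE => /M1E ymin.
  apply: (planar_EL_solution e_uniq e_all) => i.
  exact: (minimal_EL s_adm e_uniq e_all r_ge1 lt_ab s_a s_b i ymin).
split => //.
- exists (planar x); have MU : M1 s (fun=> a) (fun=> b) (planar x) by apply/M1E.
  by split => //; apply: EL.
- move=> U V MU MV; have [y yE] := M1P MU; have [z zE] := M1P MV.
  move: MU MV; rewrite yE zE => /M1E ymin /M1E zmin.
  have [lt|->|lt] := minimal_ordered s_adm e_uniq e_all r_ge1 lt_ab s_a s_b ymin zmin.
  + by constructor 1 => i; apply: lt.
  + by constructor 2.
  + by constructor 3 => i; apply: lt.
- move=> U MU i; have [y yE] := M1P MU; move: MU; rewrite yE => /M1E ymin.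
  rewrite /tau /planar !mxE mulr1.
  exact: (minimal_increasing s_adm e_uniq e_all r_ge1 lt_ab s_a s_b ymin).
Qed.
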